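(* Let $H$ be a Hopf algebra over a field $\Bbbk$, $\mathfrak{g}\subseteq(H^\circ)^+$ a bicovariant quantum tangent space, and $\mathcal{F}$ a quantum principal bundle over a quantum ringed space $(M,\mathcal{O}_M)$, with respect to the topology on $M$ induced from a finite open cover $\{U_i\}$ (the topology with base the intersections $U_I=\bigcap_{i\in I}U_i$). Then the pair $(\mathfrak{X},\mathscr{L})$ determined on the base by $$\mathfrak{X}(U_I):=\mathcal{F}(U_I)\otimes\mathfrak{g},\qquad\mathscr{L}^{U_I}\colon\mathfrak{X}(U_I)\to\mathrm{End}_\Bbbk(\mathcal{F}(U_I)),\quad\mathscr{L}^{U_I}_{f\otimes X}(g):=fg_0X(g_1),$$ is a right $H$-covariant first order vector field calculus on $\mathcal{F}$. Explicitly, the right $H$-coaction and the $\mathcal{F}$-bimodule structure are defined locally by $\Delta_{\mathfrak{X}(U_I)}(f\otimes X)=f_0\otimes X_0\otimes f_1X_1$ and $f\cdot(g\otimes X)\cdot k:=fgk_0\otimes(X\leftharpoonup k_1)$ for all $f,g,k\in\mathcal{F}(U_I)$ and $X\in\mathfrak{g}$.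
   Context: A quantum ringed space $(M,\mathcal{O}_M)$ is a topological space $M$ with a sheaf $\mathcal{O}_M$ of (noncommutative) unital algebras. The finite cover is affine, meaning each $\mathcal{O}_M(U_i)$ is a deformation of the coordinate ring of an affine variety; $I=(i_1,\dots,i_r)$ denotes multi-indices. A sheaf $\mathcal{F}$ on $M$ is a quantum principal bundle over $(M,\mathcal{O}_M)$ if it is a sheaf of right $H$-comodule algebras and there is an open cover $\{U_i\}$ with $\mathcal{F}(U_i)^{\mathrm{co}H}=\mathcal{O}_M(U_i)$ and $\mathcal{F}(U_i)$ a Hopf--Galois extension of $\mathcal{F}(U_i)^{\mathrm{co}H}$ (i.e. for $A=\mathcal{F}(U_i)$, $B=A^{\mathrm{co}H}$, the map $A\otimes_BA\to A\otimes H$, $a\otimes_Ba'\mapsto aa'_0\otimes a'_1$, is bijective). $H^\circ$ is the finite dual Hopf algebra, $\Delta(u)(h\otimes g)=u(hg)$, unit $\varepsilon$, $(H^\circ)^+=\{u\mid u(1)=0\}$. A quantum tangent space is a finite-dimensional $\mathfrak{g}\subset(H^\circ)^+$ with $\Delta(\mathfrak{g})\subset\mathfrak{g}\otimes\varepsilon+H^\circ\otimes\mathfrak{g}$; if $\Delta(\chi_i)=\chi_i\otimes\varepsilon+\sum_jf_i^j\otimes\chi_j$ for a basis $\{\chi_i\}$, put $\chi_i\leftharpoonup h:=\sum_jf_i^j(h)\chi_j$. It is bicovariant if $\mathrm{ad}_{\mathfrak{g}}(\chi)\colon h\mapsto h_1S(h_3)\chi(h_2)$ lies in $\mathfrak{g}\otimes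 H\subseteq\mathrm{End}_\Bbbk(H)$ (via $(\chi\otimes k)(h)=\chi(h)k$) for all $\chi\in\mathfrak{g}$; then $X\mapsto X_0\otimes X_1:=\mathrm{ad}_{\mathfrak{g}}(X)$ is a right coaction on $\mathfrak{g}$. $\mathrm{Hom}(\mathcal{F},\mathcal{F})$ is the sheaf $U\mapsto\mathrm{Hom}(\mathcal{F}|_U,\mathcal{F}|_U)$ of $\Bbbk$-linear sheaf morphisms. A first order vector field calculus (FOVC) on a sheaf of algebras $\mathcal{F}$ is a pair $(\mathfrak{X},\mathscr{L})$ where $\mathfrak{X}$ is a sheaf of $\mathcal{F}$-bimodules and $\mathscr{L}\colon\mathfrak{X}\to\mathrm{Hom}(\mathcal{F},\mathcal{F})$ is an injective, left $\mathcal{F}$-linear ($\mathscr{L}^U_{f\cdot X}(g)=f\mathscr{L}^U_X(g)$) sheaf morphism such that on each stalk $\mathscr{L}^p_X(fg)=\mathscr{L}^p_X(f)g+\mathscr{L}^p_{X\cdot f}(g)$ for $f,g\in\mathcal{F}_p$, $X\in\mathfrak{X}_p$. It is right $H$-covariant if $\mathfrak{X}$ is a sheaf of right $H$-covariant $\mathcal{F}$-bimodules ($H$-coactions with $\Delta(f\cdot X\cdot g)=\Delta(f)\Delta(X)\Delta(g)$) and $\mathfrak{X}\otimes\mathcal{F}\to\mathcal{F}$, $X\otimes f\mapsto\mathscr{L}_X(f)$, is a morphism of sheaves of right $H$-comodules (diagonal coaction on the source). *)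

(* Defs.v *)
From HB Require Import structures.
From mathcomp Require Import all_boot all_algebra.
From mathcomp Require Import boolp classical_sets topology freeg.

Set Implicit Arguments.
Unset Strict Implicit.
Unset Printing Implicit Defensive.
Import GRing.Theory.
Local Open Scope classical_set_scope.
Local Open Scope quotient_scope.
Local Open Scope ring_scope.

(* The [algType] of MathComp imposes 1 <> 0, whereas the sections of a sheaf of
   algebras over the empty open set form the zero algebra; and HB does not let a
   later structure combine [lmodType] and [pzRingType]. Hence this structure of
   possibly zero, associative, unital algebra. *)
HB.mixin Record Lmodule_isUnitalAlgebra (k : pzRingType) A
    of GRing.Lmodule k A := {
  uone : A;
  umul : A -> A -> A;
  umulA : associative umul;
  umul1l : left_id uone umul;
  umul1r : right_id uone umul;
  umul_linl : forall y, linear (umul^~ y);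
  umul_linr : forall x, linear (umul x)
}.

#[short(type="ualgType")]
HB.structure Definition UnitalAlgebra (k : pzRingType) :=
  {A of GRing.Lmodule k A & Lmodule_isUnitalAlgebra k A}.

Notation "x ∙ y" := (umul x y) (at level 40, left associativity) : ring_scope.

Section QuotientSpace.
Context (k : fieldType) (L : lmodType k).

Definition subspace (W : set L) :=
  W 0 /\ forall a x y, W x -> W y -> W (a *: x + y).

Definition lspan (S : set L) : set L :=
  [set x | forall W, subspace W -> S `<=` W -> W x].

Lemma lspan_subspace S : subspace (lspan S).
Proof.
split=> [W [] //|a x y Sx Sy W sW SW].
by apply: sW.2; [apply: Sx|apply: Sy].
Qed.

Lemma sub_lspan S : S `<=` lspan S.
Proof. by move=> x Sx W _; apply. Qed.

Lemma lspan_lin S a x y : lspan S x -> lspan S y -> lspan S (a *: x + y).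
Proof. exact: (lspan_subspace S).2. Qed.

Lemma lspan0 S : lspan S 0.
Proof. exact: (lspan_subspace S).1. Qed.

Lemma lspanZ S a x : lspan S x -> lspan S (a *: x).
Proof.
move=> Sx; rewrite -[a *: x]addr0.
by apply: lspan_lin => //; exact: lspan0. Qed.

Lemma lspanD S x y : lspan S x -> lspan S y -> lspan S (x + y).
Proof. by move=> Sx Sy; rewrite -[x]scale1r; apply: lspan_lin. Qed.

Lemma lspanN S x : lspan S x -> lspan S (- x).
Proof. by rewrite -scaleN1r; apply: lspanZ. Qed.

Definition quot_rel (S : set L) : rel L := fun x y => `[< lspan S (x - y) >].

Lemma quot_rel_equiv S : equiv_class_of (quot_rel S).
Proof.
split=> [x|x y|y x z].
- by apply/asboolP; rewrite subrr; apply: lspan0.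
- apply: asbool_equiv_eq; split=> [] h; rewrite -opprB; exact: lspanN h.
- move=> /asboolP xy /asboolP yz; apply/asboolP.
  by have := lspanD xy yz; rewrite addrA subrK.
Qed.

Canonical quot_equiv S := EquivRelPack (quot_rel_equiv S).

Definition quot_space (S : set L) := {eq_quot (quot_equiv S)}.

End QuotientSpace.

Section QuotientSpaceTheory.
Context (k : fieldType) (L : lmodType k) (S : set L).
Local Notation Q := (quot_space S).

HB.instance Definition _ := Choice.on Q.
HB.instance Definition _ := EqQuotient.on Q.

Definition qpi (x : L) : Q := \pi_Q x.

Lemma qpiP x y : qpi x = qpi y <-> lspan S (x - y).
Proof. by split=> [/eqmodP/asboolP|h]; last exact/eqmodP/asboolP. Qed.

Lemma qpi_repr (q : Q) : qpi (repr q) = q. Proof. exact: reprK. Qed.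

Lemma lspan_repr x : lspan S (repr (qpi x) - x).
Proof. by apply/qpiP; rewrite qpi_repr. Qed.

Definition qadd (p q : Q) : Q := qpi (repr p + repr q).
Definition qopp (p : Q) : Q := qpi (- repr p).
Definition qscale (a : k) (p : Q) : Q := qpi (a *: repr p).

Lemma qaddE x y : qadd (qpi x) (qpi y) = qpi (x + y).
Proof.
apply/qpiP; rewrite opprD addrACA.
exact: lspanD (lspan_repr x) (lspan_repr y).
Qed.

Lemma qoppE x : qopp (qpi x) = qpi (- x).
Proof. by apply/qpiP; rewrite -opprD; apply: lspanN; apply: lspan_repr. Qed.

Lemma qscaleE a x : qscale a (qpi x) = qpi (a *: x).
Proof. by apply/qpiP; rewrite -scalerBr; apply: lspanZ; apply: lspan_repr. Qed.

Lemma qaddA : associative qadd.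
Proof.
move=> x y z; rewrite -(qpi_repr x) -(qpi_repr y) -(qpi_repr z).
by rewrite !qaddE addrA.
Qed.

Lemma qaddC : commutative qadd.
Proof. by move=> x y; rewrite /qadd addrC. Qed.

Lemma qadd0 : left_id (qpi 0) qadd.
Proof. by move=> x; rewrite -(qpi_repr x) qaddE add0r. Qed.

Lemma qaddN : left_inverse (qpi 0) qopp qadd.
Proof. by move=> x; rewrite -(qpi_repr x) qoppE qaddE addNr. Qed.

HB.instance Definition _ := GRing.isZmodule.Build Q qaddA qaddC qadd0 qaddN.

Lemma qscaleA a b (x : Q) : qscale a (qscale b x) = qscale (a * b) x.
Proof. by rewrite -(qpi_repr x) !qscaleE scalerA. Qed.

Lemma qscale1 : left_id 1 qscale.
Proof. by move=> x; rewrite -(qpi_repr x) qscaleE scale1r. Qed.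

Lemma qscaleDr : right_distributive qscale +%R.
Proof.
move=> a x y; rewrite -(qpi_repr x) -(qpi_repr y) ![_ + _]qaddE.
by rewrite !qscaleE [RHS]qaddE scalerDr.
Qed.

Lemma qscaleDl (v : Q) : {morph qscale^~ v : a b / a + b}.
Proof. by move=> a b; rewrite -(qpi_repr v) !qscaleE [RHS]qaddE scalerDl. Qed.

HB.instance Definition _ :=
  GRing.Zmodule_isLmodule.Build k Q qscaleA qscale1 qscaleDr qscaleDl.

Lemma qpi_linear : linear qpi.
Proof.
move=> a x y.
by rewrite -[RHS]/(qadd (qscale a (qpi x)) (qpi y)) qscaleE qaddE.
Qed.

HB.instance Definition _ :=
  GRing.isLinear.Build k L Q _ qpi qpi_linear.

(* Evaluation at a representative: meaningful when f is constant on classes. *)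
Definition qlift (T : Type) (f : L -> T) (q : Q) : T := f (repr q).

Lemma qliftE (Z : lmodType k) (f : {linear L -> Z}) (x : L) :
  (forall s, S s -> f s = 0) -> qlift f (qpi x) = f x.
Proof.
move=> fS; apply/eqP; rewrite -subr_eq0 -linearB; apply/eqP.
have h : lspan S (repr (qpi x) - x) by exact: lspan_repr.
apply: (h [set y | f y = 0]) => //.
split=> /= [|a y z fy fz]; first exact: linear0.
by rewrite linearP fy fz scaler0 addr0.
Qed.

End QuotientSpaceTheory.

Section Tensor.
Context (k : fieldType).

Section Defs.
Context (V W : lmodType k).

Definition tens_rel : set {freeg (V * W)%type / k} :=
  [set z | exists a v v' w,
     z = << (a *: v + v', w) >> - a *: << (v, w) >> - << (v', w) >>] `|`
  [set z | exists a v w w',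
     z = << (v, a *: w + w') >> - a *: << (v, w) >> - << (v, w') >>].

Definition tens := quot_space tens_rel.

HB.instance Definition _ := GRing.Lmodule.on tens.

Definition tpure (v : V) (w : W) : tens := qpi tens_rel << (v, w) >>.

(* Meaningful when b is bilinear, see [tlift_pure] and [tlift_linear]. *)
Definition tlift (Z : lmodType k) (b : V -> W -> Z) : tens -> Z :=
  qlift (fglift (fun p : V * W => b p.1 p.2)).

End Defs.

Definition bilin (U V Z : lmodType k) (b : U -> V -> Z) :=
  (forall v, linear (b^~ v)) /\ (forall u, linear (b u)).

Definition tmap (V W V' W' : lmodType k) (f : V -> V') (g : W -> W') :
    tens V W -> tens V' W' :=
  tlift (fun v w => tpure (f v) (g w)).

Definition tassoc (U V W : lmodType k) :
    tens (tens U V) W -> tens U (tens V W) :=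
  tlift (fun t w => tlift (fun u v => tpure u (tpure v w)) t).

Lemma linear_scale (V Z : lmodType k) (f : V -> Z) (a : k) (v : V) :
  linear f -> f (a *: v) = a *: f v.
Proof.
move=> fP; have f0 : f 0 = 0 by rewrite -[X in f X](addNr 0) -scaleN1r fP
  scaleN1r addNr.
by rewrite -[a *: v]addr0 fP f0 addr0.
Qed.

Lemma fglift_linear (K : choiceType) (Z : lmodType k) (f : K -> Z) :
  linear (fglift f : {freeg K / k} -> Z).
Proof.
have fB : additive (fglift f : {freeg K / k} -> Z) by exact: lift_is_additive.
have f0 : fglift f (0 : {freeg K / k}) = 0.
  by have := fB 0 0; rewrite !subrr.
have fN (x : {freeg K / k}) : fglift f (- x) = - fglift f x.
  by have := fB 0 x; rewrite f0 !sub0r.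
have fD (x y : {freeg K / k}) : fglift f (x + y) = fglift f x + fglift f y.
  by rewrite -{1}[y]opprK fB fN opprK.
have fZ (a : k) (x : {freeg K / k}) : fglift f (a *: x) = a *: fglift f x.
  rewrite -[x]freeg_sumE; move: (dom x) => r.
  elim: r => [|z r IHr]; first by rewrite !big_nil !(scaler0, f0).
  rewrite !big_cons scalerDr !fD IHr scalerDr liftU; congr (_ + _).
  transitivity (fglift f << a * coeff z x *g z >>); last first.
    by rewrite liftU scalerA.
  congr (fglift f _); apply/eqP/freeg_eqP => y.
  by rewrite coeffZ !coeffU mulrA.
by move=> a x y; rewrite fD fZ.
Qed.

Section TensorFacts.
Context (V W Z : lmodType k).

HB.instance Definition _ (K : choiceType) (f : K -> Z) :=
  GRing.isLinear.Build k {freeg K / k} Z _ (fglift f) (fglift_linear f).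

Lemma fglift_rel (b : V -> W -> Z) : bilin b ->
  forall s, tens_rel s -> fglift (fun p : V * W => b p.1 p.2) s = 0.
Proof.
move=> [bl br] s [[a [v [v' [w ->]]]]|[a [v [w [w' ->]]]]];
  rewrite !linearB linearZ /= !liftU !scale1r /=.
  by rewrite bl addrAC addrK subrr.
by rewrite br addrAC addrK subrr.
Qed.

Lemma tlift_pure (b : V -> W -> Z) v w :
  bilin b -> tlift b (tpure v w) = b v w.
Proof. by move=> /fglift_rel h; rewrite /tlift qliftE //= liftU scale1r. Qed.

Lemma tlift_linear (b : V -> W -> Z) : bilin b -> linear (tlift b).
Proof.
move=> /fglift_rel h a s t; rewrite -(qpi_repr s) -(qpi_repr t) -linearP.
by rewrite /tlift !qliftE // linearP.
Qed.

Lemma tpure_bilin : bilin (@tpure V W).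
Proof.
split=> [w a v v'|v a w w']; rewrite -linearP; apply/qpiP; apply: sub_lspan.
  by left; exists a, v, v', w; rewrite opprD addrA.
by right; exists a, v, w, w'; rewrite opprD addrA.
Qed.

Lemma tens_sum (t : tens V W) :
  exists s : seq (V * W), t = \sum_(p <- s) tpure p.1 p.2.
Proof.
pose c : {freeg (V * W)%type / k} := repr t.
exists [seq (coeff p c *: p.1, p.2) | p <- dom c].
rewrite big_map -[LHS]qpi_repr -/c -{1}[c]freeg_sumE linear_sum /=.
apply: eq_bigr => -[v w] _ /=; set a := coeff _ _.
have -> : << a *g (v, w) >> = a *: << (v, w) >> :> {freeg (V * W)%type / k}.
  by apply/eqP/freeg_eqP => y; rewrite coeffZ !coeffU mul1r.
rewrite linearZ /=.
by rewrite (linear_scale a v (tpure_bilin.1 w)).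
Qed.

End TensorFacts.

End Tensor.

Notation "v ⊗ w" := (tpure v w) (at level 40, left associativity) : ring_scope.

(* The product (a (x) h) (b (x) h') = op a b (x) h h'. *)
Definition tprod (k : fieldType) (H : algType k) (A B C : lmodType k)
    (op : A -> B -> C) (s : tens A H) (t : tens B H) : tens C H :=
  tlift (fun a h => tlift (fun b h' => op a b ⊗ (h * h')) t) s.

Record hopf_algebra (k : fieldType) := HopfAlgebra {
  hopf_alg :> algType k;
  hcop : {linear hopf_alg -> tens hopf_alg hopf_alg};
  hcounit : {scalar hopf_alg};
  hanti : {linear hopf_alg -> hopf_alg};
  hcopA : forall h, tassoc (tmap hcop id (hcop h)) = tmap id hcop (hcop h);
  hcounitl : forall h, tlift (fun a b => hcounit a *: b) (hcop h) = h;
  hcounitr : forall h, tlift (fun a b => hcounit b *: a) (hcop h) = h;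
  hcop1 : hcop 1 = 1 ⊗ 1;
  hcopM : forall x y, hcop (x * y) = tprod *%R (hcop x) (hcop y);
  hcounit1 : hcounit 1 = 1;
  hcounitM : forall x y, hcounit (x * y) = hcounit x * hcounit y;
  hantil : forall h, tlift (fun a b => hanti a * b) (hcop h) = hcounit h *: 1;
  hantir : forall h, tlift (fun a b => a * hanti b) (hcop h) = hcounit h *: 1
}.

Section Hopf.
Context (k : fieldType) (H : hopf_algebra k).

Definition two_sided_ideal (J : set H) :=
  subspace J /\ forall x h, J x -> J (h * x) /\ J (x * h).

Definition finite_codim (J : set H) :=
  exists n (f : {linear H -> 'rV[k]_n}), J = [set h | f h = 0].

Definition finite_dual (u : {scalar H}) :=
  exists J, [/\ two_sided_ideal J, finite_codim J & forall h, J h -> u h = 0].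

(* A finite-dimensional subspace of the augmentation ideal of the finite dual,
   presented as a space with an injective evaluation into functionals.
   The last axiom is Delta(g) c g (x) eps + H° (x) g, where Delta(X) is the
   functional h (x) h' |-> X(h h'). *)
Record quantum_tangent_space := QuantumTangentSpace {
  qts_space :> vectType k;
  qts_ev : qts_space -> {scalar H};
  qts_ev_linear : forall a X Y h,
    qts_ev (a *: X + Y) h = a * qts_ev X h + qts_ev Y h;
  qts_ev_inj : forall X Y, qts_ev X =1 qts_ev Y -> X = Y;
  qts_finite_dual : forall X, finite_dual (qts_ev X);
  qts_augmentation : forall X, qts_ev X 1 = 0;
  qts_cop : forall X, exists Y n (u : 'I_n -> {scalar H}) (Z : 'I_n -> qts_space),
    (forall l, finite_dual (u l)) /\
    forall h h', qts_ev X (h * h') =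
      qts_ev Y h * hcounit H h' + \sum_l u l h * qts_ev (Z l) h'
}.

Section TangentSpace.
Context (g : quantum_tangent_space).
Local Notation b := (vbasis (fullv : {vspace g})).

Lemma qts_coefP (X : g) :
  exists c : 'I_(\dim (fullv : {vspace g})) -> H -> k, forall h h',
    qts_ev X (h * h') =
    qts_ev X h * hcounit H h' + \sum_j c j h * qts_ev b`_j h'.
Proof.
have [Y [n [u [Z [_ XE]]]]] := qts_cop X.
have XY h : qts_ev X h = qts_ev Y h.
  have := XE h 1; rewrite mulr1 hcounit1 mulr1 big1 ?addr0 // => l _.
  by rewrite qts_augmentation mulr0.
have ev0 h : qts_ev (0 : g) h = 0.
  have := qts_ev_linear (-1) (0 : g) 0 h.
  by rewrite scaler0 addr0 mulN1r addNr.
have evZ h (v : g) :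
    qts_ev v h = \sum_j coord b j v * qts_ev b`_j h.
  rewrite {1}(coord_vbasis (memvf v)).
  elim/big_rec2: _ => [|j s t _ <-]; first exact: ev0.
  exact: qts_ev_linear.
exists (fun j h => \sum_l coord b j (Z l) * u l h) => h h'.
rewrite XE XY; congr (_ + _).
under eq_bigr do rewrite evZ mulr_sumr.
rewrite exchange_big; apply: eq_bigr => j _; rewrite mulr_suml.
by apply: eq_bigr => l _; rewrite mulrCA mulrA.
Qed.

(* The functionals f_i^j with Delta(chi_i) = chi_i (x) eps + f_i^j (x) chi_j;
   they are unique because the chi_j are linearly independent. *)
Definition qts_coef (i j : 'I_(\dim (fullv : {vspace g}))) (h : H) : k :=
  projT1 (cid (qts_coefP b`_i)) j h.

(* X ↼ h; the result does not depend on the basis. *)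
Definition qts_act (X : g) (h : H) : g :=
  \sum_i coord b i X *: \sum_j qts_coef i j h *: b`_j.

(* h |-> h_1 S(h_3) X(h_2) *)
Definition qts_ad (X : g) (h : H) : H :=
  tlift (fun h1 h23 =>
      tlift (fun h2 h3 => qts_ev X h2 *: (h1 * hanti H h3)) h23)
    (tmap id (hcop H) (hcop H h)).

(* The embedding of g (x) H into End(H). *)
Definition qts_end (t : tens g H) (h : H) : H :=
  tlift (fun X h' => qts_ev X h *: h') t.

Definition bicovariant := forall X : g, exists t, qts_end t =1 qts_ad X.

End TangentSpace.

Record bicovariant_qts := BicovariantQts {
  bqts :> quantum_tangent_space;
  bqts_bicovariant : bicovariant bqts
}.

Definition qts_coact (g : bicovariant_qts) (X : g) : tens g H :=
  projT1 (cid (bqts_bicovariant X)).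

Definition comodule (V : lmodType k) (r : V -> tens V H) :=
  [/\ linear r,
      forall v, tassoc (tmap r id (r v)) = tmap id (hcop H) (r v) &
      forall v, tlift (fun w h => hcounit H h *: w) (r v) = v].

Definition comodule_algebra (A : ualgType k) (r : A -> tens A H) :=
  [/\ comodule r, r (uone : A) = uone ⊗ 1 &
      forall a a', r (a ∙ a') = tprod umul (r a) (r a')].

(* The diagonal coaction v (x) w |-> v_0 (x) w_0 (x) v_1 w_1. *)
Definition diag_coact (V W : lmodType k) (rV : V -> tens V H)
    (rW : W -> tens W H) : tens V W -> tens (tens V W) H :=
  tlift (fun v w => tprod (@tpure k V W) (rV v) (rW w)).

Definition colinear (V W : lmodType k) (rV : V -> tens V H)
    (rW : W -> tens W H) (f : V -> W) :=
  forall v, rW (f v) = tmap f id (rV v).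

Section HopfGalois.
Context (A : ualgType k) (r : A -> tens A H).

Definition coinvariants : set A := [set a | r a = a ⊗ 1].

Definition balanced_rel (B : set A) : set (tens A A) :=
  [set z | exists a b a', B b /\ z = (a ∙ b) ⊗ a' - a ⊗ (b ∙ a')].

(* The canonical map A (x)_B A -> A (x) H, where B = A^coH. *)
Definition galois_map : quot_space (balanced_rel coinvariants) -> tens A H :=
  qlift (tlift (fun a a' => tmap (umul a) id (r a'))).

Definition hopf_galois := bijective galois_map.

End HopfGalois.

End Hopf.

Record opens (X : topologicalType) := Opens {
  oset :> set X;
  oopen : open oset
}.

Definition opens_cap (X : topologicalType) (U V : opens X) : opens X :=
  Opens (openI (oopen U) (oopen V)).

Lemma opens_capl (X : topologicalType) (U V : opens X) :
  opens_cap U V `<=` U.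
Proof. exact: subIsetl. Qed.

Lemma opens_capr (X : topologicalType) (U V : opens X) :
  opens_cap U V `<=` V.
Proof. exact: subIsetr. Qed.

Record presheaf (k : fieldType) (X : topologicalType) := Presheaf {
  psec :> opens X -> lmodType k;
  pres : forall U V : opens X, V `<=` U -> {linear psec U -> psec V};
  pres_id : forall (U : opens X) (p : U `<=` U) s, pres p s = s;
  pres_comp : forall (U V W : opens X) (p : V `<=` U) (q : W `<=` V)
    (r : W `<=` U) s, pres q (pres p s) = pres r s
}.

Arguments pres {k X} {P U V} p : rename.

Definition is_sheaf (k : fieldType) (X : topologicalType)
    (P : presheaf k X) :=
  forall (J : Type) (V : J -> opens X) (U : opens X),
    oset U = \bigcup_j V j ->
  forall s : (forall j, P (V j)),
    (forall i j (W : opens X) (p : W `<=` V i) (q : W `<=` V j),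
      pres p (s i) = pres q (s j)) ->
  exists! t : P U, forall j (p : V j `<=` U), pres p t = s j.

Record alg_presheaf (k : fieldType) (X : topologicalType) := AlgPresheaf {
  asec :> opens X -> ualgType k;
  ares : forall U V : opens X, V `<=` U -> {linear asec U -> asec V};
  ares1 : forall (U V : opens X) (p : V `<=` U), ares p uone = uone;
  aresM : forall (U V : opens X) (p : V `<=` U) s t,
    ares p (s ∙ t) = ares p s ∙ ares p t;
  ares_id : forall (U : opens X) (p : U `<=` U) s, ares p s = s;
  ares_comp : forall (U V W : opens X) (p : V `<=` U) (q : W `<=` V)
    (r : W `<=` U) s, ares q (ares p s) = ares r s
}.

Arguments ares {k X} {P U V} p : rename.

Definition alg_to_presheaf (k : fieldType) (X : topologicalType)
    (P : alg_presheaf k X) : presheaf k X :=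
  Presheaf (@ares_id k X P) (@ares_comp k X P).

Section HomSheaf.
Context (k : fieldType) (X : topologicalType) (P Q : presheaf k X).

Record hom_sec (U : opens X) := HomSec {
  hfun : forall V : opens X, V `<=` U -> P V -> Q V;
  hfun_linear : forall (V : opens X) (p : V `<=` U), linear (hfun p);
  hfun_nat : forall (V W : opens X) (p : V `<=` U) (q : W `<=` U)
    (r : W `<=` V) s, pres r (hfun p s) = hfun q (pres r s)
}.

Definition hom_res (U V : opens X) (p : V `<=` U) (f : hom_sec U) : hom_sec V :=
  @HomSec V (fun W q => hfun f (subset_trans q p))
    (fun W q => hfun_linear f (subset_trans q p))
    (fun W W' q q' => hfun_nat f (subset_trans q p) (subset_trans q' p)).

End HomSheaf.

Section Stalks.
Context (k : fieldType) (X : topologicalType).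

Record germ (P : presheaf k X) (p : X) := Germ {
  germ_dom : opens X;
  germ_in : oset germ_dom p;
  germ_sec : P germ_dom
}.

Definition germ_eq (P : presheaf k X) (p : X) (x y : germ P p) :=
  exists (W : opens X) (i : W `<=` germ_dom x) (j : W `<=` germ_dom y),
    oset W p /\ pres i (germ_sec x) = pres j (germ_sec y).

Definition stalk (P : presheaf k X) (p : X) :=
  {A : set (germ P p) | exists x, A = [set y | germ_eq x y]}.

Definition stalk_of (P : presheaf k X) (p : X) (x : germ P p) : stalk P p :=
  exist _ [set y | germ_eq x y] (ex_intro _ x erefl).

Definition stalk_rep (P : presheaf k X) (p : X) (a : stalk P p) : germ P p :=
  projT1 (cid (proj2_sig a)).

(* Meaningful when op commutes with restrictions. *)
Definition stalk_op (P Q R : presheaf k X) (op : forall U, P U -> Q U -> R U)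
    (p : X) (a : stalk P p) (b : stalk Q p) : stalk R p :=
  let x := stalk_rep a in let y := stalk_rep b in
  @stalk_of R p (@Germ R p (opens_cap (germ_dom x) (germ_dom y))
    (conj (germ_in x) (germ_in y))
    (op _ (pres (@opens_capl _ _ _) (germ_sec x))
          (pres (@opens_capr _ _ _) (germ_sec y)))).

End Stalks.

Section Calculus.
Context (k : fieldType) (H : hopf_algebra k) (X : topologicalType).

Record comodule_algebra_sheaf := ComoduleAlgebraSheaf {
  cas_presheaf :> alg_presheaf k X;
  cas_is_sheaf : is_sheaf (alg_to_presheaf cas_presheaf);
  cas_coact : forall U, cas_presheaf U -> tens (cas_presheaf U) H;
  cas_comodule_algebra : forall U, comodule_algebra (@cas_coact U);
  cas_nat : forall (U V : opens X) (p : V `<=` U) s,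
    cas_coact (ares p s) = tmap (ares p) id (cas_coact s)
}.

(* The equality F(V_j)^coH = O(V_j) is read as an isomorphism of algebras for
   each member V_j of the cover. *)
Definition quantum_principal_bundle (O : alg_presheaf k X)
    (F : comodule_algebra_sheaf) :=
  exists (J : Type) (V : J -> opens X),
    \bigcup_j V j = [set: X] /\
    forall j,
      (exists i : {linear O (V j) -> F (V j)},
        [/\ i uone = uone, forall s t, i (s ∙ t) = i s ∙ i t, injective i &
            range i = coinvariants (@cas_coact F (V j))]) /\
      hopf_galois (@cas_coact F (V j)).

Context (F : comodule_algebra_sheaf).
Local Notation F_ := (alg_to_presheaf F).

(* A sheaf of vector spaces with the operations of a right H-covariant first
   order vector field calculus on F, before any of its axioms is imposed. *)
Record precalculus := Precalculus {
  vf :> presheaf k X;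
  vf_is_sheaf : is_sheaf vf;
  vf_l : forall U, F U -> vf U -> vf U;
  vf_r : forall U, vf U -> F U -> vf U;
  vf_coact : forall U, vf U -> tens (vf U) H;
  vf_L : forall U, vf U -> hom_sec F_ F_ U;
  vf_l_bilin : forall U, bilin (@vf_l U);
  vf_r_bilin : forall U, bilin (@vf_r U);
  vf_coact_linear : forall U, linear (@vf_coact U);
  vf_L_linear : forall (U V : opens X) (p : V `<=` U) (f : F V),
    linear (fun x : vf U => hfun (vf_L x) p f);
  vf_l_nat : forall (U V : opens X) (p : V `<=` U) f x,
    pres p (vf_l f x) = vf_l (ares p f) (pres p x);
  vf_r_nat : forall (U V : opens X) (p : V `<=` U) x f,
    pres p (vf_r x f) = vf_r (pres p x) (ares p f);
  vf_coact_nat : forall (U V : opens X) (p : V `<=` U) x,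
    vf_coact (pres p x) = tmap (pres p) id (vf_coact x);
  vf_L_nat : forall (U V : opens X) (p : V `<=` U) x,
    vf_L (pres p x) = hom_res p (vf_L x)
}.

Section Laws.
Context (D : precalculus).

Definition is_bimodule_sheaf := forall U : opens X,
  [/\ forall x : D U, vf_l uone x = x,
      forall f f' (x : D U), vf_l (f ∙ f') x = vf_l f (vf_l f' x),
      forall x : D U, vf_r x uone = x,
      forall (x : D U) f f', vf_r x (f ∙ f') = vf_r (vf_r x f) f' &
      forall f (x : D U) f', vf_r (vf_l f x) f' = vf_l f (vf_r x f')].

Definition vf_app (U : opens X) (x : D U) (f : F U) : F U :=
  hfun (vf_L x) (@subset_refl _ U) f.

Definition stalk_mul (p : X) : stalk F_ p -> stalk F_ p -> stalk F_ p :=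
  stalk_op (P := F_) (Q := F_) (R := F_) (fun U (f f' : F U) => f ∙ f') (p := p).
Definition stalk_add (p : X) : stalk F_ p -> stalk F_ p -> stalk F_ p :=
  stalk_op (P := F_) (Q := F_) (R := F_) (fun U (f f' : F U) => f + f') (p := p).
Definition stalk_r (p : X) : stalk D p -> stalk F_ p -> stalk D p :=
  stalk_op (P := D) (Q := F_) (R := D) (@vf_r D) (p := p).
Definition stalk_L (p : X) : stalk D p -> stalk F_ p -> stalk F_ p :=
  stalk_op (P := D) (Q := F_) (R := F_) vf_app (p := p).

Definition is_fovc :=
  [/\ is_bimodule_sheaf,
      forall U : opens X, injective (@vf_L D U),
      forall (U V : opens X) (p : V `<=` U) f (x : D U) f',
        hfun (vf_L (vf_l f x)) p f' = ares p f ∙ hfun (vf_L x) p f' &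
      forall (p : X) (x : stalk D p) (f f' : stalk F_ p),
        stalk_L x (stalk_mul f f') =
        stalk_add (stalk_mul (stalk_L x f) f') (stalk_L (stalk_r x f) f')].

Definition is_covariant := forall U : opens X,
  [/\ comodule (@vf_coact D U),
      forall f (x : D U) f', vf_coact (vf_r (vf_l f x) f') =
        tprod (@vf_r D U) (tprod (@vf_l D U) (cas_coact f) (vf_coact x))
          (cas_coact f') &
      colinear (diag_coact (@vf_coact D U) (@cas_coact F U)) (@cas_coact F U)
        (tlift (@vf_app U))].

End Laws.

Definition precalculus_iso (D D' : precalculus)
    (phi : forall U : opens X, D U -> D' U) :=
  [/\ forall U, linear (phi U) /\ bijective (phi U),
      forall (U V : opens X) (p : V `<=` U) x,
        pres p (phi U x) = phi V (pres p x),
      forall U f (x : D U), phi U (vf_l f x) = vf_l f (phi U x) /\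
        phi U (vf_r x f) = vf_r (phi U x) f,
      forall U, colinear (@vf_coact D U) (@vf_coact D' U) (phi U) &
      forall U (x : D U), vf_L (phi U x) = vf_L x].

End Calculus.

Record finite_cover (M : topologicalType) := FiniteCover {
  fc_index : finType;
  fc_set :> fc_index -> set M;
  fc_open : forall i, open (fc_set i);
  fc_cover : \bigcup_i fc_set i = [set: M]
}.

(* C is a parameter because it determines the topology. *)
Definition cover_space (M : topologicalType) (C : finite_cover M) : Type := M.

Section CoverTopology.
Context (M : topologicalType) (C : finite_cover M).

Definition multi_index := {I : seq (fc_index C) | I != [::]}.

Definition cover_cap (I : multi_index) : set M :=
  [set x | forall i, i \in val I -> C i x].

Definition cover_open (A : set M) :=
  exists S : set multi_index, A = \bigcup_(I in S) cover_cap I.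

Lemma cover_openT : cover_open [set: M].
Proof.
exists setT; apply/esym; rewrite -subTset => x _.
have : (\bigcup_i C i) x by rewrite fc_cover.
move=> [i _ Cix]; have i0 : [:: i] != [::] by [].
by exists (exist _ [:: i] i0) => // j; rewrite inE => /eqP ->.
Qed.

Lemma cover_openI : setI_closed cover_open.
Proof.
move=> A B [S ->] [T ->].
exists [set K | exists I J, [/\ S I, T J & val K = val I ++ val J]].
apply/seteqP; split=> x.
- move=> [[I SI xI] [J TJ xJ]].
  have IJ0 : val I ++ val J != [::].
    by case: I {SI xI} => -[|i I] //=.
  exists (exist _ (val I ++ val J) IJ0); first by exists I, J.
  by move=> i; rewrite mem_cat => /orP[/xI|/xJ].
- move=> [K [I [J [SI TJ KE]]] xK]; split.
    by exists I => // i iI; apply: xK; rewrite KE mem_cat iI.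
  by exists J => // i iJ; apply: xK; rewrite KE mem_cat iJ orbT.
Qed.

Lemma cover_open_bigU (J : Type) (f : J -> set M) :
  (forall j, cover_open (f j)) -> cover_open (\bigcup_j f j).
Proof.
move=> fo; exists [set I | exists j, cover_cap I `<=` f j].
apply/seteqP; split=> [x [j _ fjx]|x [I [j fj] /fj fjx]]; last by exists j.
have [S fS] := fo j; move: fjx; rewrite fS => -[I SI xI].
by exists I => //; exists j; rewrite fS => y yI; exists I.
Qed.

HB.instance Definition _ := Choice.on (cover_space C).
HB.instance Definition _ := isOpenTopological.Build (cover_space C)
  cover_openT cover_openI cover_open_bigU.

Lemma cover_cap_open I : @open (cover_space C) (cover_cap I).
Proof.
exists [set I]; apply/seteqP; split=> x; first by exists I.
by move=> [J ->].
Qed.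

Definition base_open (I : multi_index) : opens (cover_space C) :=
  Opens (cover_cap_open I).

Lemma open_cover_space (U : opens (cover_space C)) : open (U : set M).
Proof.
case: U => ? /= [S ->]; apply: bigcup_open => I _.
have -> : cover_cap I = \big[setI/setT]_(i <- val I) C i.
  apply/seteqP; split=> x.
    move=> xI; rewrite -bigcap_seq => i /= iI; exact: xI.
  by rewrite -bigcap_seq => xI i iI; apply: xI.
elim/big_ind: _ => [|A B|i _]; [exact: openT|exact: openI|exact: fc_open].
Qed.

Definition coarse_presheaf (k : fieldType) (O : alg_presheaf k M) :
    alg_presheaf k (cover_space C) :=
  let e (U : opens (cover_space C)) : opens M := Opens (open_cover_space U) in
  @AlgPresheaf k (cover_space C) (fun U => O (e U))
    (fun U V p => @ares k M O (e U) (e V) p)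
    (fun U V p => @ares1 k M O (e U) (e V) p)
    (fun U V p => @aresM k M O (e U) (e V) p)
    (fun U p => @ares_id k M O (e U) p)
    (fun U V W p q r => @ares_comp k M O (e U) (e V) (e W) p q r).

Context (k : fieldType) (H : hopf_algebra k) (g : bicovariant_qts H).
Context (F : comodule_algebra_sheaf H (cover_space C)).

(* D has the prescribed values on the base, i : F(U_I) (x) g -> X(U_I) being
   the identification. The formulas for the two one-sided actions combine to
   f . (f' (x) Y) . f'' = f f' f''_0 (x) (Y ↼ f''_1). *)
Definition given_on_base (D : precalculus F)
    (i : forall I : multi_index, tens (F (base_open I)) g -> D (base_open I)) :=
  [/\ forall I, linear (i I) /\ bijective (i I),
      forall (I J : multi_index) (p : base_open J `<=` base_open I) t,
        pres p (i I t) = i J (tmap (ares p) id t),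
      forall I f f' (Y : g),
        vf_l f (i I (f' ⊗ Y)) = i I ((f ∙ f') ⊗ Y) /\
        vf_r (i I (f ⊗ Y)) f' =
          i I (tlift (fun f0 f1 => (f ∙ f0) ⊗ qts_act Y f1) (cas_coact f')),
      forall I f (Y : g),
        vf_coact (i I (f ⊗ Y)) =
          tmap (i I) id
            (tprod (@tpure k (F (base_open I)) g) (cas_coact f) (qts_coact Y)) &
      forall I f (Y : g) f',
        vf_app (i I (f ⊗ Y)) f' =
          tlift (fun f0 f1 => qts_ev Y f1 *: (f ∙ f0)) (cas_coact f')].

End CoverTopology.

(* Main.v *)
Require Import Defs.
From HB Require Import structures.
From mathcomp Require Import all_boot all_algebra.
From mathcomp Require Import boolp classical_sets topology freeg.

Set Implicit Arguments.
Unset Strict Implicit.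
Unset Printing Implicit Defensive.
Import GRing.Theory.
Local Open Scope classical_set_scope.
Local Open Scope ring_scope.

(** Write x0 (x) x1 for coproducts and coactions, X.h for the action of h on X,
    S for the antipode and X(h) for the value of X in g at h in H.

    Existence. Since g is finite-dimensional, the functor F(-) (x) g is a finite
    direct sum of copies of F, hence a sheaf on all open sets and not only on the
    base; [std_calculus] equips it with the operations of the statement. Each
    law is then an identity in A (x) g for one comodule algebra A = F(U), and
    follows from two facts about g: the action satisfies
    (X.h)(h') = X(h h') - X(h) eps(h') ([ev_act]), and bicovariance makes g a
    Yetter-Drinfeld module ([coact_comodule], [coact_act]). The latter is
    derived from the adjoint formula for the coaction, in the equivalent form
    X0(h1) X1 h2 = h1 X(h2) ([ev_coact_mul], [ev_mul_separated]).

    Injectivity of L. Suppose that x = sum f_i (x) X_i acts as zero on all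
    sections over open subsets of U. Over W = U cap V_j the canonical map of
    F(V_j), restricted to W, still reaches every 1 (x) h. Writing 1 (x) h as
    sum a a'0 (x) a'1 and applying b (x) c |-> b0 (x) b1 S(c) gives
    sum a0 a' (x) a1 = 1 (x) S(h), so that the vanishing of sum f_i a0 X_i(a1)
    for all a yields sum X_i(S(h)) f_i = 0 for every h ([std_app_faithful]). It
    remains to see that X is determined by X o S ([ev_anti_inj]). The antipode
    may fail to be surjective, so this uses that g is finite-dimensional. The
    kernel N of X |-> X o S is stable under the operators X |-> X.S(h), and a subspace of a
    finite-dimensional module with this property is a submodule
    ([antipode_stable_sub]). For X in N one then gets
    0 = (X.h1)(S(h2)) = - X(h).

    Uniqueness. The base determines a sheaf and the morphisms out of it, so two
    solutions are isomorphic by gluing the identifications over the base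
    ([base_extension]); all the operations are compatible with the isomorphism
    because they are so on the base. For the coactions this needs that
    restriction to the base separates the elements of D(U) (x) H
    ([base_separated_tens]), which holds because over a field an element of
    V (x) W is determined by its slices in V ([tens_separated_r]). Consequently
    every solution is isomorphic to the standard one, and the laws are
    transported along the isomorphism. *)

(* Linear subspaces, not subspace topologies. *)
Local Notation subspace := Defs.subspace.

(** * Separation of vectors by linear functionals *)

Section Functionals.
Context (k : fieldType) (L : lmodType k).
Implicit Type W : set L.

Lemma subspaceZ W a x : subspace W -> W x -> W (a *: x).
Proof. by move=> [W0 WP] Wx; rewrite -[_ *: _]addr0; apply: WP. Qed.

Lemma subspaceD W x y : subspace W -> W x -> W y -> W (x + y).
Proof. by move=> [W0 WP] Wx Wy; rewrite -[x]scale1r; apply: WP. Qed.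

Lemma subspace_sum W (I : Type) (r : seq I) (P : pred I) (E : I -> L) :
  subspace W -> (forall i, P i -> W (E i)) -> W (\sum_(i <- r | P i) E i).
Proof.
move=> sW WE; elim/big_rec: _ => [|i x Pi Wx]; first exact: sW.1.
exact: subspaceD (WE i Pi) Wx.
Qed.

(** A subspace that is maximal among those avoiding x is a hyperplane not
    containing x: any vector outside it generates, together with it, a subspace
    containing x. *)
Lemma maximal_avoiding_subspace W x : subspace W -> ~ W x ->
  exists A, [/\ subspace A, W `<=` A, ~ A x &
    forall y, exists a, A (y - a *: x)].
Proof.
move=> sW Wx.
(* With the empty set, P is also stable under the union of the empty chain. *)
pose P A := A = set0 \/ [/\ subspace A, W `<=` A & ~ A x].
have [F FP Ft|A [PA Amax]] := @Zorn_bigcup L P.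
  have [[A [FA A0]]|noA] := pselect (exists A, F A /\ A <> set0); last first.
    left; rewrite -subset0 => y [A FA Ay]; apply: noA; exists A; split=> //.
    by move=> A0; move: Ay; rewrite A0.
  right; have [//|[sA WA Ax]] := FP _ FA.
  split=> [|y Wy|[B FB Bx]]; last 2 first.
  - by exists A => //; apply: WA.
  - by have [B0|[_ _ /(_ Bx)]] := FP _ FB; first by rewrite B0 in Bx.
  split=> [|a y z [B FB By] [C FC Cz]]; first by exists A => //; exact: sA.1.
  have [BC|CB] := Ft _ _ FB FC.
    have [C0|[sC _ _]] := FP _ FC; first by rewrite C0 in Cz.
    by exists C => //; apply: sC.2 => //; apply: BC.
  have [B0|[sB _ _]] := FP _ FB; first by rewrite B0 in By.
  by exists B => //; apply: sB.2 => //; apply: CB.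
case: PA => [A0|[sA WA Ax]].
  suff AW : A `<` W by case: (Amax W AW); right; split=> //; exact: subset_refl.
  by rewrite A0; split=> [? []|/(_ 0 sW.1)].
exists A; split=> // y.
have [Ay|Ay] := pselect (A y); first by exists 0; rewrite scale0r subr0.
pose B := [set z | exists a, A (z - a *: y)].
have sB : subspace B.
  split=> [|a z t [b Az] [c At]].
    by exists 0; rewrite scale0r subr0; exact: sA.1.
  exists (a * b + c); rewrite scalerDl -scalerA opprD addrACA -scalerBr.
  exact: sA.2.
have AB : A `<=` B by move=> z Az; exists 0; rewrite scale0r subr0.
have By : B y by exists 1; rewrite scale1r subrr; exact: sA.1.
have [a Axy] : B x.
  apply: contrapT => Bx; apply: (Amax B); last by right; split=> // z /WA /AB.
  by split=> // BA; apply: Ay; apply: BA.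
have a0 : a != 0.
  by apply/eqP => a0; apply: Ax; rewrite a0 scale0r subr0 in Axy.
exists a^-1.
have -> : y - a^-1 *: x = (- a^-1) *: (x - a *: y).
  by rewrite scalerBr !scaleNr opprK scalerA mulVf // scale1r addrC.
exact: subspaceZ.
Qed.

(** The functional is the coefficient of x in the decomposition of a vector
    along a hyperplane containing W and avoiding x. *)
Lemma separating_functional W x : subspace W -> ~ W x ->
  exists phi : {scalar L}, phi x = 1 /\ forall y, W y -> phi y = 0.
Proof.
move=> sW Wx; have [A [sA WA Ax Ad]] := maximal_avoiding_subspace sW Wx.
pose f y : k := projT1 (cid (Ad y)).
have fP y : A (y - f y *: x) by rewrite /f; case: cid.
have f_uniq y a : A (y - a *: x) -> f y = a.
  move=> Aya; apply/eqP; rewrite -subr_eq0; apply/eqP.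
  have Afa : A ((f y - a) *: x).
    have -> : (f y - a) *: x = - 1 *: (y - f y *: x) + (y - a *: x).
      by rewrite scalerBl scaleN1r opprB addrA subrK.
    exact: sA.2.
  apply: contrapT => /eqP fa; apply: Ax; rewrite -[x]scale1r -(mulVf fa) -scalerA.
  exact: subspaceZ.
have f_linear : scalar f.
  move=> a y z; apply: f_uniq; rewrite /= scalerDl -scalerA opprD addrACA.
  by rewrite -scalerBr; apply: sA.2.
pose phi : {scalar L} := HB.pack f (GRing.isLinear.Build k L k _ f f_linear).
exists phi; split=> [|y Wy]; apply: f_uniq.
  by rewrite scale1r subrr; exact: sA.1.
by rewrite scale0r subr0; apply: WA.
Qed.

End Functionals.

(** * Sums over tensors and multilinear expressions *)

Section LinearMaps.
Context (k : fieldType).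
Implicit Types U V W Z : lmodType k.

Lemma linD U Z (f : U -> Z) x y : linear f -> f (x + y) = f x + f y.
Proof. by move=> lf; rewrite -[x]scale1r lf !scale1r. Qed.

Lemma lin0 U Z (f : U -> Z) : linear f -> f 0 = 0.
Proof. by move=> lf; rewrite -(scale0r 0) (linear_scale _ _ lf) scale0r. Qed.

Lemma linB U Z (f : U -> Z) x y : linear f -> f (x - y) = f x - f y.
Proof.
by move=> lf; rewrite -scaleN1r linD // (linear_scale _ _ lf) scaleN1r.
Qed.

Lemma lin_big U Z (f : U -> Z) (I : Type) (r : seq I) (P : pred I) (E : I -> U) :
  linear f -> f (\sum_(i <- r | P i) E i) = \sum_(i <- r | P i) f (E i).
Proof.
move=> lf; rewrite (big_morph f (fun x y => linD x y lf) (lin0 lf)) //.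
Qed.

Definition tseq V W (t : tens V W) : seq (V * W) := projT1 (cid (tens_sum t)).

Lemma tseqE V W (t : tens V W) : t = \sum_(p <- tseq t) p.1 ⊗ p.2.
Proof. by rewrite /tseq; case: cid. Qed.

(** The sum of b v w over the terms of a chosen expression of t: Sweedler
    notation when t is a coproduct or a coaction. Linear maps can be moved
    through it with no condition on b; bilinearity of b only matters when t is
    rewritten. *)
Definition tsum V W Z (t : tens V W) (b : V -> W -> Z) : Z :=
  \sum_(p <- tseq t) b p.1 p.2.

Lemma eq_tsum V W Z (t : tens V W) (b b' : V -> W -> Z) :
  (forall v w, b v w = b' v w) -> tsum t b = tsum t b'.
Proof. by move=> bb'; apply: eq_bigr => p _; apply: bb'. Qed.

Lemma tliftE V W Z (t : tens V W) (b : V -> W -> Z) :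
  bilin b -> tlift b t = tsum t b.
Proof.
move=> bb; rewrite {1}[t]tseqE lin_big; last exact: tlift_linear.
by apply: eq_bigr => p _; rewrite tlift_pure.
Qed.

Lemma tsum_pure V W Z (b : V -> W -> Z) v w :
  bilin b -> tsum (v ⊗ w) b = b v w.
Proof. by move=> bb; rewrite -tliftE // tlift_pure. Qed.

Lemma tsum_tpure V W (t : tens V W) : tsum t (@tpure k V W) = t.
Proof. by rewrite [RHS]tseqE. Qed.

Lemma tsum_linear V W Z (b : V -> W -> Z) :
  bilin b -> linear (fun t => tsum t b).
Proof. by move=> bb a x y; rewrite -!tliftE // tlift_linear. Qed.

Lemma tsum0 V W Z (b : V -> W -> Z) : bilin b -> tsum 0 b = 0.
Proof. by move=> bb; exact: (lin0 (tsum_linear bb)). Qed.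

Lemma lin_tsum V W Z Z' (f : Z -> Z') (t : tens V W) (b : V -> W -> Z) :
  linear f -> f (tsum t b) = tsum t (fun v w => f (b v w)).
Proof. by move=> lf; rewrite /tsum lin_big. Qed.

Lemma tsum_tsum V W V' W' Z (t : tens V W) (c : V -> W -> tens V' W')
    (b : V' -> W' -> Z) : bilin b ->
  tsum (tsum t c) b = tsum t (fun v w => tsum (c v w) b).
Proof. by move=> bb; apply: (lin_tsum t c (tsum_linear bb)). Qed.

Lemma tsumD V W Z (t : tens V W) (b b' : V -> W -> Z) :
  tsum t (fun v w => b v w + b' v w) = tsum t b + tsum t b'.
Proof. exact: big_split. Qed.

Lemma tsumB V W Z (t : tens V W) (b b' : V -> W -> Z) :
  tsum t (fun v w => b v w - b' v w) = tsum t b - tsum t b'.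
Proof. exact: sumrB. Qed.

Lemma tsum_exchange V W V' W' Z (t : tens V W) (t' : tens V' W')
    (b : V -> W -> V' -> W' -> Z) :
  tsum t (fun v w => tsum t' (fun v' w' => b v w v' w')) =
  tsum t' (fun v' w' => tsum t (fun v w => b v w v' w')).
Proof. exact: exchange_big. Qed.

(** The structure on U is an argument here. For U a tensor product, [linear]
    infers another structure, which is only convertible to the one that [bilin]
    and the lemmas above use. *)
Definition is_linear U Z (f : U -> Z) := linear f.

Lemma tens_linear_ext V W Z (f f' : tens V W -> Z) :
  is_linear f -> is_linear f' -> (forall v w, f (v ⊗ w) = f' (v ⊗ w)) ->
  forall t, f t = f' t.
Proof.
move=> lf lf' ff' t; rewrite [t]tseqE !lin_big //.
by apply: eq_bigr => p _; apply: ff'.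
Qed.

Lemma linear_id U : linear (fun x : U => x).
Proof. by []. Qed.

Lemma linear_map U Z Z' (f : {linear Z -> Z'}) (E : U -> Z) :
  linear E -> linear (fun x => f (E x)).
Proof. by move=> lE a x y; rewrite lE linearP. Qed.

Lemma linear_compose U Z Z' (f : Z -> Z') (E : U -> Z) :
  linear f -> linear E -> linear (fun x => f (E x)).
Proof. by move=> lf lE a x y; rewrite lE lf. Qed.

Lemma linear_scalel U Z Z' (phi : {scalar Z}) (E : U -> Z) (c : Z') :
  linear E -> linear (fun x => phi (E x) *: c).
Proof. by move=> lE a x y; rewrite lE linearP scalerDl scalerA. Qed.

Lemma linear_scaler U Z (c : k) (E : U -> Z) :
  linear E -> linear (fun x => c *: E x).
Proof.
by move=> lE a x y; rewrite lE scalerDr !scalerA mulrC.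
Qed.

Lemma linear_add U Z (E E' : U -> Z) :
  linear E -> linear E' -> linear (fun x => E x + E' x).
Proof. by move=> lE lE' a x y; rewrite lE lE' scalerDr addrACA. Qed.

Lemma linear_mull (A : algType k) U (E : U -> A) c :
  linear E -> linear (fun x => E x * c).
Proof. by move=> lE a x y; rewrite lE mulrDl scalerAl. Qed.

Lemma linear_mulr (A : algType k) U (E : U -> A) c :
  linear E -> linear (fun x => c * E x).
Proof. by move=> lE a x y; rewrite lE mulrDr scalerAr. Qed.

Lemma linear_umull (A : ualgType k) U (E : U -> A) c :
  linear E -> linear (fun x => E x ∙ c).
Proof. by move=> lE a x y; rewrite lE umul_linl. Qed.

Lemma linear_umulr (A : ualgType k) U (E : U -> A) c :
  linear E -> linear (fun x => c ∙ E x).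
Proof. by move=> lE a x y; rewrite lE umul_linr. Qed.

Lemma linear_tpurel V W U (E : U -> V) (w : W) :
  linear E -> linear (fun x => E x ⊗ w).
Proof. by move=> lE a x y; rewrite lE (tpure_bilin V W).1. Qed.

Lemma linear_tpurer V W U (E : U -> W) (v : V) :
  linear E -> linear (fun x => v ⊗ E x).
Proof. by move=> lE a x y; rewrite lE (tpure_bilin V W).2. Qed.

Lemma linear_tsum U V W Z (t : U -> tens V W) (b : V -> W -> Z) :
  bilin b -> linear t -> linear (fun x => tsum (t x) b).
Proof. by move=> bb lt a x y; rewrite lt tsum_linear. Qed.

Lemma linear_tsum_in U V W Z (t : tens V W) (b : V -> W -> U -> Z) :
  (forall v w, linear (b v w)) -> linear (fun x => tsum t (fun v w => b v w x)).
Proof.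
move=> lb a x y; rewrite /tsum scaler_sumr -big_split /=.
by apply: eq_bigr => p _; rewrite lb.
Qed.

Lemma linear_bilinl U V W Z (b : V -> W -> Z) (E : U -> V) w :
  bilin b -> linear E -> linear (fun x => b (E x) w).
Proof. by case=> b1 _ lE a x y; rewrite lE; apply: b1. Qed.

Lemma linear_bilinr U V W Z (b : V -> W -> Z) (E : U -> W) v :
  bilin b -> linear E -> linear (fun x => b v (E x)).
Proof. by case=> _ b2 lE a x y; rewrite lE; apply: b2. Qed.

Definition trilin U V W Z (T : U -> V -> W -> Z) :=
  [/\ forall v w, linear (fun u => T u v w), forall u w, linear (fun v => T u v w) &
      forall u v, linear (fun w => T u v w)].

Lemma linear_trilin1 U V W U' Z (T : U -> V -> W -> Z) (E : U' -> U) v w :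
  trilin T -> linear E -> linear (fun x => T (E x) v w).
Proof. by case=> b _ _ lE; move=> a x y; rewrite lE; apply: b. Qed.
Lemma linear_trilin2 U V W U' Z (T : U -> V -> W -> Z) (E : U' -> V) u w :
  trilin T -> linear E -> linear (fun x => T u (E x) w).
Proof. by case=> _ b _ lE; move=> a x y; rewrite lE; apply: b. Qed.
Lemma linear_trilin3 U V W U' Z (T : U -> V -> W -> Z) (E : U' -> W) u v :
  trilin T -> linear E -> linear (fun x => T u v (E x)).
Proof. by case=> _ _ b lE; move=> a x y; rewrite lE; apply: b. Qed.

End LinearMaps.

Arguments is_linear {k} U Z f.

(* Linearity of an expression built from the linear and bilinear maps above and
   from hypotheses, by recursion on its head. The hook is extended when new
   operations are introduced. *)
Ltac lin_hook := fail.
Ltac lin := intros; cbv beta;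
  lazymatch goal with
  | |- bilin _ => split; lin
  | |- trilin _ => split; lin
  | |- @GRing.linear_for _ (Defs_tens__canonical__GRing_LSemiModule ?k ?V ?W)
         _ _ ?f =>
      change (is_linear (Defs_tens__canonical__GRing_Lmodule k V W) _ f);
      unfold is_linear; lin
  | |- is_linear _ _ _ => unfold is_linear; lin
  | |- GRing.linear_for _ (fun x => x) => refine (@linear_id _ _)
  | |- GRing.linear_for _ (fun x => @tsum _ _ _ _ _ _) =>
      first [refine (linear_tsum_in _ _) | refine (linear_tsum _ _)]; lin
  | |- GRing.linear_for _ (fun x => _ ⊗ _) =>
      first [refine (linear_tpurel _ _) | refine (linear_tpurer _ _)]; lin
  | |- GRing.linear_for _ (fun x => _ + _) => refine (linear_add _ _); lin
  | |- GRing.linear_for _ (fun x => _ * _) =>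
      first [refine (linear_mull _ _) | refine (linear_mulr _ _)]; lin
  | |- GRing.linear_for _ (fun x => _ ∙ _) =>
      first [refine (linear_umull _ _) | refine (linear_umulr _ _)]; lin
  | |- GRing.linear_for _ (fun x => _ *: _) =>
      first [ refine (linear_scaler _ _); lin | refine (linear_scalel _ _ _); lin
            | lin_other ]
  | |- GRing.linear_for _ (fun x => GRing.Linear.sort _ _) =>
      refine (linear_map _ _); lin
  | |- GRing.linear_for _ (fun x => _) => lin_other
  | |- @GRing.linear_for ?R ?U ?V ?s ?f =>
      change (@GRing.linear_for R U V s (fun x => f x)); lin
  end
with lin_other :=
  first [ match goal with
          | B : GRing.linear_for _ ?f |- GRing.linear_for _ ?f => exact B
          | B : bilin ?b |- GRing.linear_for _ (fun x => ?b _ _) =>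
            first [refine (linear_bilinl _ B _) | refine (linear_bilinr _ B _)]; lin
          | B : trilin ?b |- GRing.linear_for _ (fun x => ?b _ _ _) =>
            first [refine (linear_trilin1 _ _ B _) | refine (linear_trilin2 _ _ B _)
                  | refine (linear_trilin3 _ _ B _)]; lin
          | B : GRing.linear_for _ ?f |- GRing.linear_for _ (fun x => ?f _) =>
            refine (linear_compose B _); lin
          end
        | lin_hook ].

Section TensorSeparation.
Context (k : fieldType).

Lemma tmapE (V W V' W' : lmodType k) (f : V -> V') (h : W -> W') (t : tens V W) :
  linear f -> linear h -> tmap f h t = tsum t (fun v w => f v ⊗ h w).
Proof. by move=> lf lh; rewrite /tmap tliftE //; lin. Qed.

Lemma tmap_pure (V W V' W' : lmodType k) (f : V -> V') (h : W -> W') v w :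
  linear f -> linear h -> tmap f h (v ⊗ w) = f v ⊗ h w.
Proof. by move=> lf lh; rewrite tmapE // tsum_pure //; lin. Qed.

Lemma linear_tmap (V W V' W' : lmodType k) (f : V -> V') (h : W -> W') :
  linear f -> linear h -> linear (tmap f h).
Proof. by move=> lf lh a x y; rewrite !tmapE // tsum_linear //; lin. Qed.

Lemma tsum_tmap (V W V' W' Z : lmodType k) (f : V -> V') (h : W -> W')
    (b : V' -> W' -> Z) (t : tens V W) :
  linear f -> linear h -> bilin b ->
  tsum (tmap f h t) b = tsum t (fun v w => b (f v) (h w)).
Proof.
move=> lf lh bb; rewrite tmapE // tsum_tsum //.
by apply: eq_tsum => v w; rewrite tsum_pure.
Qed.

Lemma tprodE (H : algType k) (A B C : lmodType k) (op : A -> B -> C)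
    (s : tens A H) (t : tens B H) : bilin op ->
  tprod op s t =
  tsum s (fun a h => tsum t (fun b h' => op a b ⊗ (h * h'))).
Proof.
move=> bop; rewrite -tliftE; last by lin.
rewrite /tprod; congr (tlift _ s); apply/funext => a; apply/funext => h.
by rewrite tliftE //; lin.
Qed.

(** Elements of V (x) W are separated by the maps id (x) phi. By induction on the
    length of an expression: either the last vector of W is a combination of the
    others, and the expression can be shortened, or a functional that equals 1
    there and vanishes on the others shows that its coefficient is zero. *)
Lemma tens_separated_r (V W : lmodType k) (t : tens V W) :
  (forall phi : {scalar W}, tsum t (fun v w => phi w *: v) = 0) -> t = 0.
Proof.
suff main n : forall (v : nat -> V) (w : nat -> W),
    (forall phi : {scalar W}, \sum_(i < n) phi (w i) *: v i = 0) ->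
    \sum_(i < n) v i ⊗ w i = 0.
  rewrite {2}[t]tseqE /tsum => h.
  rewrite (big_nth (0, 0)) big_mkord.
  apply: (main _ (fun i => (nth (0, 0) (tseq t) i).1)
                 (fun i => (nth (0, 0) (tseq t) i).2)) => phi.
  by have := h phi; rewrite (big_nth (0, 0)) big_mkord.
elim: n => [|n IHn] v w vw0; first by rewrite big_ord0.
pose S := [set y | exists c : nat -> k, y = \sum_(i < n) c i *: w i].
have sS : subspace S.
  split=> [|a _ _ [c ->] [d ->]].
    by exists (fun=> 0); rewrite big1 // => i _; rewrite scale0r.
  exists (fun i => a * c i + d i).
  rewrite scaler_sumr -big_split /=; apply: eq_bigr => i _.
  by rewrite scalerDl scalerA.
have Sw (i : 'I_n) : S (w i).
  exists (fun j => (j == i :> nat)%:R).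
  rewrite (bigD1 i) //= eqxx scale1r big1 ?addr0 //.
  by move=> j ji; rewrite (negbTE ji : (nat_of_ord j == i) = false) scale0r.
have [[c wn]|Swn] := pselect (S (w n)); last first.
  have [phi [phin phi0]] := separating_functional sS Swn.
  have vn : v n = 0.
    have := vw0 phi; rewrite big_ord_recr /= phin scale1r big1 ?add0r // => i _.
    by rewrite phi0 // scale0r.
  rewrite big_ord_recr /= vn (lin0 ((tpure_bilin V W).1 _)) addr0.
  apply: IHn => psi.
  by have := vw0 psi; rewrite big_ord_recr /= vn scaler0 addr0.
pose v' i := v i + c i *: v n.
transitivity (\sum_(i < n) v' i ⊗ w i).
  rewrite big_ord_recr /= wn (lin_big _ _ _ ((tpure_bilin V W).2 _)) -big_split /=.
  apply: eq_bigr => i _ /=; rewrite /v' [v i + _]addrC (tpure_bilin V W).1.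
  by rewrite (linear_scale _ _ ((tpure_bilin V W).2 _)) addrC.
apply: IHn => psi; rewrite -[RHS](vw0 psi) big_ord_recr /= wn linear_sum.
rewrite scaler_suml -big_split; apply: eq_bigr => i _ /=.
by rewrite /v' scalerDr (linearZ_LR psi) /= !scalerA mulrC.
Qed.

Definition tswap (V W : lmodType k) (t : tens V W) : tens W V :=
  tsum t (fun v w => w ⊗ v).

Lemma tens_separated_l (V W : lmodType k) (t : tens V W) :
  (forall phi : {scalar V}, tsum t (fun v w => phi v *: w) = 0) -> t = 0.
Proof.
move=> t0; have tK : tsum (tswap t) (fun w v => v ⊗ w) = t.
  rewrite tsum_tsum; last by lin.
  rewrite -[RHS]tsum_tpure; apply: eq_tsum => v w.
  by rewrite tsum_pure //; lin.
rewrite -tK; suff -> : tswap t = 0 by rewrite tsum0 //; lin.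
apply: tens_separated_r => phi; rewrite tsum_tsum; last by lin.
by rewrite -[RHS](t0 phi); apply: eq_tsum => v w; rewrite tsum_pure //; lin.
Qed.

(** A separating family of functionals phi_i on W suffices, even though it need
    not span the dual of W: each slice (psi (x) id) t is killed by all phi_i,
    as phi_i ((psi (x) id) t) = psi ((id (x) phi_i) t). *)
Lemma tens_separated_family (I : Type) (V W : lmodType k)
    (phi : I -> {scalar W}) (t : tens V W) :
  (forall w, (forall i, phi i w = 0) -> w = 0) ->
  (forall i, tsum t (fun v w => phi i w *: v) = 0) -> t = 0.
Proof.
move=> phi_sep t0; apply: tens_separated_l => psi; apply: phi_sep => i.
rewrite /tsum linear_sum.
transitivity (psi (tsum t (fun v w => phi i w *: v))); last first.
  by rewrite t0 linear0.
rewrite /tsum linear_sum; apply: eq_bigr => p _.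
by rewrite !linearZ /= mulrC.
Qed.

Lemma tens_separated_familyl (I : Type) (V W : lmodType k)
    (phi : I -> {scalar V}) (t : tens V W) :
  (forall v, (forall i, phi i v = 0) -> v = 0) ->
  (forall i, tsum t (fun v w => phi i v *: w) = 0) -> t = 0.
Proof.
move=> phi_sep t0; apply: tens_separated_r => psi; apply: phi_sep => i.
rewrite /tsum linear_sum.
transitivity (psi (tsum t (fun v w => phi i v *: w))); last first.
  by rewrite t0 linear0.
rewrite /tsum linear_sum; apply: eq_bigr => p _.
by rewrite !linearZ /= mulrC.
Qed.

End TensorSeparation.
Section TensorProducts.
Context (k : fieldType).

Lemma tassocE (U V W : lmodType k) (t : tens (tens U V) W) :
  tassoc t = tsum t (fun s w => tsum s (fun u v => u ⊗ (v ⊗ w))).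
Proof.
rewrite -tliftE; last by lin.
rewrite /tassoc; congr (tlift _ t); apply/funext => s; apply/funext => w.
by rewrite tliftE //; lin.
Qed.

Lemma bilin_tprod (H : algType k) (A B C : lmodType k) (op : A -> B -> C) :
  bilin op -> bilin (@tprod k H A B C op).
Proof.
move=> bop.
have -> : @tprod k H A B C op = fun s t =>
    tsum s (fun a h => tsum t (fun b h' => op a b ⊗ (h * h'))).
  by apply/funext => s; apply/funext => t; apply: tprodE.
by lin.
Qed.

Lemma tprod_pure (H : algType k) (A B C : lmodType k) (op : A -> B -> C)
    a h b h' : bilin op ->
  tprod op (a ⊗ h) (b ⊗ h') = op a b ⊗ (h * h') :> tens C H.
Proof.
by move=> bop; rewrite tprodE // !tsum_pure //; lin.
Qed.

End TensorProducts.

(** * Sweedler calculus in comodules and Hopf algebras *)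

Section HopfCalculus.
Context (k : fieldType) (H : hopf_algebra k).
Local Notation Δ := (hcop H).
Local Notation ε := (hcounit H).
Local Notation S := (hanti H).

Section Comodule.
Context (V : lmodType k) (r : V -> tens V H).
Hypothesis r_comodule : comodule r.

Lemma comodule_linear : linear r.
Proof. by case: r_comodule. Qed.

(** The summand is an arbitrary trilinear map, so that this one rule serves for
    all iterated coactions and, with [regular_comodule], coproducts. *)
Lemma coact_coassoc (Z : lmodType k) (T : V -> H -> H -> Z) v : trilin T ->
  tsum (r v) (fun v0 v1 => tsum (r v0) (fun a b => T a b v1)) =
  tsum (r v) (fun v0 v1 => tsum (Δ v1) (fun a b => T v0 a b)).
Proof.
move=> T3; have [rl /(_ v) rA _] := r_comodule.
pose f z := tsum z (fun u t => tsum t (fun h h' => T u h h')).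
have := congr1 f rA; rewrite /f tassocE tsum_tsum; last by lin.
rewrite !tsum_tmap //; try by lin.
move=> <-; apply: eq_tsum => v0 v1; rewrite tsum_tsum; last by lin.
by apply: eq_tsum => a b; rewrite !tsum_pure //; lin.
Qed.

Lemma coact_counit (Z : lmodType k) (T : V -> Z) v : linear T ->
  tsum (r v) (fun v0 v1 => ε v1 *: T v0) = T v.
Proof.
move=> lT; have [rl _ /(_ v) rC] := r_comodule.
rewrite -[in RHS]rC tliftE; last by lin.
rewrite (lin_tsum _ _ lT).
by apply: eq_tsum => v0 v1; rewrite (linear_scale _ _ lT).
Qed.

End Comodule.

(** It is enough to compare both sides on pure tensors. *)
Lemma colinear_diagP (V A : lmodType k) (rV : V -> tens V H)
    (r : A -> tens A H) (app : V -> A -> A) :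
  linear rV -> linear r -> bilin app ->
  colinear (diag_coact rV r) r (tlift app) <->
  forall x f, r (app x f) = tsum (rV x) (fun y c => tsum (r f) (fun f0 f1 =>
    app y f0 ⊗ (c * f1))).
Proof.
move=> lV rl ba.
have -> : tlift app = fun t => tsum t app.
  by apply/funext => t; rewrite tliftE.
have -> : diag_coact rV r = fun t => tsum t (fun x f =>
    tsum (rV x) (fun y c => tsum (r f) (fun f0 f1 => (y ⊗ f0) ⊗ (c * f1)))).
  apply/funext => t; rewrite -tliftE; last by lin.
  rewrite /diag_coact; congr (tlift _ t); apply/funext => x; apply/funext => f.
  by rewrite tprodE //; lin.
have pureE x f : tmap (fun t => tsum t app) id (tsum (x ⊗ f) (fun x f =>
    tsum (rV x) (fun y c => tsum (r f) (fun f0 f1 => (y ⊗ f0) ⊗ (c * f1))))) =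
    tsum (rV x) (fun y c => tsum (r f) (fun f0 f1 => app y f0 ⊗ (c * f1))).
  rewrite tsum_pure; last by lin.
  rewrite tmapE; [|by lin|by lin].
  rewrite tsum_tsum; last by lin.
  apply: eq_tsum => y c; rewrite tsum_tsum; last by lin.
  apply: eq_tsum => f0 f1; rewrite tsum_pure; last by lin.
  by rewrite tsum_pure.
split=> [appC x f|appE t].
  by have := appC (x ⊗ f); rewrite pureE tsum_pure.
rewrite [RHS]tmapE; [|by lin|by lin].
move: t; apply: tens_linear_ext; [by lin|by lin|move=> x f].
rewrite -tmapE; [|by lin|by lin].
by rewrite pureE tsum_pure // appE.
Qed.

Lemma regular_comodule : comodule Δ.
Proof. by split; [exact: linearP|exact: hcopA|exact: hcounitr]. Qed.

Definition sw_coassoc (Z : lmodType k) (T : H -> H -> H -> Z) h :=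
  @coact_coassoc _ _ regular_comodule Z T h.

Definition sw_counitr (Z : lmodType k) (T : H -> Z) h :=
  @coact_counit _ _ regular_comodule Z T h.

Lemma sw_counitl (Z : lmodType k) (T : H -> Z) h : linear T ->
  tsum (Δ h) (fun a b => ε a *: T b) = T h.
Proof.
move=> lT; rewrite -[in RHS](hcounitl h) tliftE; last by lin.
rewrite (lin_tsum _ _ lT).
by apply: eq_tsum => v0 v1; rewrite (linear_scale _ _ lT).
Qed.

Lemma sw_antil (Z : lmodType k) (T : H -> Z) h : linear T ->
  tsum (Δ h) (fun a b => T (S a * b)) = ε h *: T 1.
Proof.
move=> lT; rewrite -(linear_scale _ _ lT) -hantil tliftE; last by lin.
by rewrite (lin_tsum _ _ lT).
Qed.

Lemma sw_antir (Z : lmodType k) (T : H -> Z) h : linear T ->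
  tsum (Δ h) (fun a b => T (a * S b)) = ε h *: T 1.
Proof.
move=> lT; rewrite -(linear_scale _ _ lT) -hantir tliftE; last by lin.
by rewrite (lin_tsum _ _ lT).
Qed.

Lemma swM (Z : lmodType k) (T : H -> H -> Z) x y : bilin T ->
  tsum (Δ (x * y)) T =
  tsum (Δ x) (fun a b => tsum (Δ y) (fun c d => T (a * c) (b * d))).
Proof.
move=> bT; rewrite hcopM tprodE; last by lin.
rewrite tsum_tsum //; apply: eq_tsum => a b; rewrite tsum_tsum //.
by apply: eq_tsum => c d; rewrite tsum_pure.
Qed.

(** Both sides are evaluations of the sum of S(x1 y1) (x2 y2) (S(y3) S(x3)),
    which collapses from the right and from the left. *)
Lemma antiM x y : S (x * y) = S y * S x.
Proof.
pose T x1 x2 x3 y1 y2 y3 := S (x1 * y1) * ((x2 * y2) * (S y3 * S x3)).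
transitivity (tsum (Δ x) (fun x1 x' => tsum (Δ x') (fun x2 x3 =>
    tsum (Δ y) (fun y1 y' => tsum (Δ y') (fun y2 y3 => T x1 x2 x3 y1 y2 y3))))).
  rewrite -(@sw_counitr _ (fun x1 => S (x1 * y))); last by lin.
  apply: eq_tsum => x1 x'; rewrite -[S (x1 * y)]mulr1.
  rewrite -(@sw_antir _ (fun a => S (x1 * y) * a)); last by lin.
  apply: eq_tsum => x2 x3.
  rewrite -(@sw_counitr _ (fun y1 => S (x1 * y1) * (x2 * S x3))); last by lin.
  apply: eq_tsum => y1 y'; rewrite -[x2 in LHS]mulr1.
  rewrite -(@sw_antir _ (fun a => S (x1 * y1) * (x2 * a * S x3))); last by lin.
  by apply: eq_tsum => y2 y3; rewrite /T !mulrA.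
rewrite -(@sw_coassoc _ (fun x1 x2 x3 => tsum (Δ y) (fun y1 y' =>
  tsum (Δ y') (fun y2 y3 => T x1 x2 x3 y1 y2 y3)))); last by rewrite /T; lin.
rewrite -[RHS](@sw_counitl _ (fun x3 => S y * S x3)); last by lin.
apply: eq_tsum => a x3.
transitivity (tsum (Δ a) (fun x1 x2 => tsum (Δ y) (fun b y3 =>
    tsum (Δ b) (fun y1 y2 => T x1 x2 x3 y1 y2 y3)))).
  by apply: eq_tsum => x1 x2; rewrite sw_coassoc //; rewrite /T; lin.
rewrite tsum_exchange.
rewrite -[in RHS](@sw_counitl _ (fun y3 => S y3 * S x3)); last by lin.
rewrite (lin_tsum _ _ (f := fun z => ε a *: z)); last by lin.
apply: eq_tsum => b y3.
transitivity (tsum (Δ (a * b)) (fun p q => S p * q * (S y3 * S x3))).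
  rewrite swM; last by lin.
  by apply: eq_tsum => x1 x2; apply: eq_tsum => y1 y2; rewrite /T mulrA.
rewrite (@sw_antil _ (fun c => c * (S y3 * S x3))); last by lin.
by rewrite mul1r hcounitM scalerA.
Qed.

Local Notation m2 := (tprod (@GRing.mul H)).

Lemma bilin_mul : bilin (@GRing.mul H).
Proof. by lin. Qed.

Lemma m2A (s t u : tens H H) : m2 s (m2 t u) = m2 (m2 s t) u.
Proof.
have bm := bilin_tprod H bilin_mul.
move: s; apply: tens_linear_ext; [by lin|by lin|move=> a a'].

move: t; apply: tens_linear_ext; [by lin|by lin|move=> b b'].
move: u; apply: tens_linear_ext; [by lin|by lin|move=> c c'].
by rewrite !tprod_pure ?mulrA //; exact: bilin_mul.
Qed.

Lemma m2_1l (t : tens H H) : m2 (1 ⊗ 1) t = t.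
Proof.
have bm := bilin_tprod H bilin_mul.
move: t; apply: tens_linear_ext; [by lin|by lin|move=> b b'].
by rewrite !tprod_pure ?mul1r //; exact: bilin_mul.
Qed.

Lemma m2_1r (t : tens H H) : m2 t (1 ⊗ 1) = t.
Proof.
have bm := bilin_tprod H bilin_mul.
move: t; apply: tens_linear_ext; [by lin|by lin|move=> b b'].
by rewrite !tprod_pure ?mulr1 //; exact: bilin_mul.
Qed.

(** With cop the coproduct, h |-> cop(S(h)) is a left convolution inverse of cop
    and h |-> S(h2) (x) S(h1) a right one. Hence they agree: both result from
    collapsing cop(S(h1)) cop(h2) (S(h4) (x) S(h3)). *)
Lemma hcop_anti h : Δ (S h) = tsum (Δ h) (fun a b => S b ⊗ S a).
Proof.
have bm := bilin_tprod H bilin_mul.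
pose Q h := tsum (Δ h) (fun a b => S b ⊗ S a).
have lQ : linear Q by rewrite /Q; lin.
have DQ h' : tsum (Δ h') (fun b c => m2 (Δ b) (Q c)) = ε h' *: (1 ⊗ 1).
  transitivity (tsum (Δ h') (fun b1 d => tsum (Δ d) (fun e q =>
      tsum (Δ e) (fun b2 p => (b1 * S q) ⊗ (b2 * S p))))).
    transitivity (tsum (Δ h') (fun b c => tsum (Δ b) (fun b1 b2 =>
        tsum (Δ c) (fun p q => (b1 * S q) ⊗ (b2 * S p))))).
      apply: eq_tsum => b c; rewrite tprodE; last exact: bilin_mul.
      apply: eq_tsum => b1 b2; rewrite tsum_tsum; last by lin.
      by apply: eq_tsum => p q; rewrite tsum_pure //; lin.
    rewrite sw_coassoc; last by lin.
    apply: eq_tsum => b1 d.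
    by rewrite -(@sw_coassoc _ (fun b2 p q => (b1 * S q) ⊗ (b2 * S p))) //; lin.
  rewrite -(@sw_antir _ (fun x => x ⊗ 1)); last by lin.
  apply: eq_tsum => b1 d.
  rewrite -[RHS](@sw_counitl _ (fun q => (b1 * S q) ⊗ 1)); last by lin.
  apply: eq_tsum => e q.
  by rewrite (@sw_antir _ (fun x => (b1 * S q) ⊗ x)) //; lin.
rewrite -[RHS]/(Q h).
transitivity (tsum (Δ h) (fun a h' => tsum (Δ h') (fun b c =>
  m2 (m2 (Δ (S a)) (Δ b)) (Q c)))).
  rewrite -(@sw_counitr _ (fun a => Δ (S a))); last by lin.
  apply: eq_tsum => a h'.
  transitivity (m2 (Δ (S a)) (ε h' *: (1 ⊗ 1))).
    by rewrite (linear_scale _ _ (bm.2 _)) m2_1r.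
  rewrite -DQ (lin_tsum _ _ (bm.2 _)).
  by apply: eq_tsum => b c; rewrite m2A.
rewrite -(@sw_coassoc _ (fun a b c => m2 (m2 (Δ (S a)) (Δ b)) (Q c))); last by lin.
rewrite -[RHS](@sw_counitl _ Q) //; apply: eq_tsum => d c.
transitivity (m2 (Δ (ε d *: 1)) (Q c)); last first.
  by rewrite linearZ /= hcop1 (linear_scale _ _ (bm.1 _)) m2_1l.
rewrite -(@sw_antil _ (fun x => x)); last by lin.
rewrite (@lin_tsum _ _ _ _ _ (fun x => m2 (Δ x) (Q c))); last by lin.
by apply: eq_tsum => a b; rewrite hcopM.
Qed.

End HopfCalculus.
(** * The tangent space as a Yetter-Drinfeld module *)

Section TangentSpace.
Context (k : fieldType) (H : hopf_algebra k) (g : quantum_tangent_space H).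
Local Notation Δ := (hcop H).
Local Notation ε := (hcounit H).
Local Notation S := (hanti H).
Implicit Types (X Y : g) (h : H).

(** Evaluation at h as a functional of X; these functionals separate g. *)
Definition evat h X : k := qts_ev X h.

Lemma evat_linear h : scalar (evat h).
Proof. by move=> a X Y; apply: qts_ev_linear. Qed.

HB.instance Definition _ h :=
  GRing.isLinear.Build k g k _ (evat h) (evat_linear h).

Lemma evE X h : qts_ev X h = (evat h : {scalar g}) X.
Proof. by []. Qed.

Lemma linear_evl (U Z : lmodType k) (E : U -> g) h (c : Z) :
  linear E -> linear (fun x => qts_ev (E x) h *: c).
Proof. by move=> lE a x y; rewrite lE qts_ev_linear scalerDl scalerA. Qed.

Lemma evD X Y h : qts_ev (X + Y) h = qts_ev X h + qts_ev Y h.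
Proof. by rewrite !evE linearD. Qed.
Lemma evZ a X h : qts_ev (a *: X) h = a * qts_ev X h.
Proof. by rewrite !evE linearZ. Qed.
Lemma ev0 h : qts_ev (0 : g) h = 0.
Proof. by rewrite evE linear0. Qed.

(** This formula characterises the action without reference to a basis; all
    the properties of the action are derived from it. *)
Lemma ev_act X h h' :
  qts_ev (qts_act X h) h' = qts_ev X (h * h') - qts_ev X h * ε h'.
Proof.
pose b := vbasis (fullv : {vspace g}).
have XE : X = \sum_i coord b i X *: b`_i by rewrite -coord_vbasis ?memvf.
rewrite [in RHS]XE !evE !linear_sum mulr_suml -sumrB; apply: eq_bigr => i _.
rewrite !linearZ /= -mulrA -mulrBr; congr (_ * _).
have := projT2 (cid (qts_coefP b`_i)) h h'; rewrite -/(qts_coef i _ _).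
rewrite /evat => ->; rewrite addrC addKr -/(evat h' _) linear_sum.
by apply: eq_bigr => j _; rewrite linearZ.
Qed.

Lemma ev_ext X Y : (forall h, qts_ev X h = qts_ev Y h) -> X = Y.
Proof. exact: qts_ev_inj. Qed.

Lemma bilin_act : bilin (@qts_act k H g).
Proof.
split=> [h|X] a x y; apply: ev_ext => h'.
  by rewrite !(ev_act, evD, evZ) mulrDl mulrBr opprD addrACA mulrA.
rewrite !(ev_act, evD, evZ) mulrDl -scalerAl !scalarP mulrDl mulrBr mulrA.
by rewrite opprD addrACA.
Qed.

Lemma act_mul X h h' : qts_act X (h * h') = qts_act (qts_act X h) h'.
Proof.
apply: ev_ext => y; rewrite !ev_act hcounitM mulrBl opprB addrA.
by rewrite [qts_ev X h * (_ * _)]mulrA subrK mulrA.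
Qed.

Lemma act1 X : qts_act X 1 = X.
Proof.
by apply: ev_ext => h; rewrite ev_act mul1r qts_augmentation mul0r subr0.
Qed.

Lemma ev_separated (W : lmodType k) (t t' : tens g W) :
  (forall h, tsum t (fun Y w => qts_ev Y h *: w) =
             tsum t' (fun Y w => qts_ev Y h *: w)) -> t = t'.
Proof.
move=> tt'; apply/eqP; rewrite -subr_eq0; apply/eqP.
apply: (@tens_separated_familyl _ _ _ _ evat) => [X X0|h].
  by apply: ev_ext => h; rewrite ev0; apply: X0.
rewrite (linB (f := fun t => tsum t (fun Y w => evat h Y *: w))); last by lin.
by rewrite /evat tt' subrr.
Qed.

End TangentSpace.

Ltac lin_hook ::=
  lazymatch goal with
  | |- GRing.linear_for _ (fun x => GRing.Linear.sort (qts_ev _) _ *: _) =>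
      refine (linear_evl _ _ _); lin
  | |- GRing.linear_for _ (fun x => qts_act _ _) =>
      first [refine (linear_bilinl _ (bilin_act _) _)
            |refine (linear_bilinr _ (bilin_act _) _)]; lin
  end.

Section Coadjoint.
Context (k : fieldType) (H : hopf_algebra k) (g : bicovariant_qts H).
Local Notation Δ := (hcop H).
Local Notation ε := (hcounit H).
Local Notation S := (hanti H).
Local Notation δ := (@qts_coact k H g).
Implicit Types (X Y : g) (h : H).

Lemma ev_coact X h :
  tsum (δ X) (fun Y c => qts_ev Y h *: c) =
  tsum (Δ h) (fun h1 h' => tsum (Δ h') (fun h2 h3 =>
    qts_ev X h2 *: (h1 * S h3))).
Proof.
have := projT2 (cid (bqts_bicovariant X)) h; rewrite -/(qts_coact X).
rewrite /qts_end tliftE; last by lin.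
move=> ->; rewrite /qts_ad.
pose f (h1 : H) (h23 : tens H H) := tsum h23 (fun h2 h3 => qts_ev X h2 *: (h1 * S h3)).
transitivity (tlift f (tmap id Δ (Δ h))).
  congr (tlift _ _); apply/funext => h1; apply/funext => t.
  by rewrite tliftE //; lin.
by rewrite tliftE ?tsum_tmap //; rewrite /f; lin.
Qed.

Lemma coact_linear : linear δ.
Proof.
move=> a X Y; apply: ev_separated => h.
rewrite (@tsum_linear _ _ _ _ (fun Y w => qts_ev Y h *: w)); last by lin.
rewrite !ev_coact.
have l : linear (fun X => tsum (Δ h) (fun h1 h' => tsum (Δ h') (fun h2 h3 =>
    qts_ev X h2 *: (h1 * S h3)))) by lin.
exact: l.
Qed.

(** X0(h1) X1 h2 = h1 X(h2): the adjoint formula for the coaction with S(h3)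
    cancelled on the right. *)
Lemma ev_coact_mul X h :
  tsum (Δ h) (fun h1 h2 => tsum (δ X) (fun Y c => qts_ev Y h1 *: (c * h2))) =
  tsum (Δ h) (fun h1 h2 => qts_ev X h2 *: h1).
Proof.
transitivity (tsum (Δ h) (fun h' h4 => tsum (Δ h') (fun h1 h'' =>
  tsum (Δ h'') (fun h2 h3 => qts_ev X h2 *: (h1 * S h3 * h4))))).
  apply: eq_tsum => h' h4.
  transitivity (tsum (δ X) (fun Y c => qts_ev Y h' *: c) * h4).
    rewrite (lin_tsum (f := fun c => c * h4)); last by lin.
    by apply: eq_tsum => h2 h3; rewrite -scalerAl.
  rewrite ev_coact (lin_tsum (f := fun c => c * h4)); last by lin.
  apply: eq_tsum => h1 h''; rewrite (lin_tsum (f := fun c => c * h4)); last by lin.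
  by apply: eq_tsum => h2 h3; rewrite -scalerAl.
rewrite (sw_coassoc (T := fun h1 h'' h4 => tsum (Δ h'') (fun h2 h3 =>
  qts_ev X h2 *: (h1 * S h3 * h4)))); last by lin.
apply: eq_tsum => h1 d.
rewrite (sw_coassoc (T := fun h2 h3 h4 => qts_ev X h2 *: (h1 * S h3 * h4)));
  last by lin.
rewrite -(sw_counitr (T := fun h2 => qts_ev X h2 *: h1)); last by lin.
apply: eq_tsum => h2 e.
transitivity (tsum (Δ e) (fun a b => qts_ev X h2 *: (h1 * (S a * b)))).
  by apply: eq_tsum => a b; rewrite mulrA.
rewrite (sw_antil (T := fun c => qts_ev X h2 *: (h1 * c))); last by lin.
by rewrite mulr1.
Qed.

(** Conversely, multiplying the expression of [ev_coact_mul] by S(h3) on the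
    right recovers t0(h) t1, and these values determine t. *)
Lemma ev_mul_separated (t t' : tens g H) :
  (forall h, tsum (Δ h) (fun h1 h2 => tsum t (fun Y c => qts_ev Y h1 *: (c * h2)))
    = tsum (Δ h) (fun h1 h2 => tsum t' (fun Y c => qts_ev Y h1 *: (c * h2)))) ->
  t = t'.
Proof.
move=> tt'; apply: ev_separated => h.
have key (u : tens g H) : tsum u (fun Y c => qts_ev Y h *: c) =
    tsum (Δ h) (fun a b => tsum (Δ a) (fun h1 h2 =>
      tsum u (fun Y c => qts_ev Y h1 *: (c * h2))) * S b).
  transitivity (tsum (Δ h) (fun a b => tsum (Δ a) (fun h1 h2 =>
      tsum u (fun Y c => qts_ev Y h1 *: (c * h2 * S b))))); last first.
    apply: eq_tsum => a b; rewrite (lin_tsum (f := fun c => c * S b)); last by lin.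
    apply: eq_tsum => h1 h2; rewrite (lin_tsum (f := fun c => c * S b)); last by lin.
    by apply: eq_tsum => Y c; rewrite -scalerAl.
  rewrite (sw_coassoc (T := fun h1 h2 b =>
    tsum u (fun Y c => qts_ev Y h1 *: (c * h2 * S b)))); last by lin.
  rewrite -(sw_counitr (T := fun h => tsum u (fun Y c => qts_ev Y h *: c)));
    last by lin.
  apply: eq_tsum => h1 d; rewrite tsum_exchange.
  rewrite (lin_tsum (f := fun c => ε d *: c)); last by lin.
  apply: eq_tsum => Y c.
  transitivity (tsum (Δ d) (fun a b => qts_ev Y h1 *: (c * (a * S b)))).
    rewrite (sw_antir (T := fun x => qts_ev Y h1 *: (c * x))); last by lin.
    by rewrite mulr1.
  by apply: eq_tsum => a b; rewrite mulrA.
by rewrite !key; apply: eq_tsum => a b; rewrite tt'.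
Qed.

(** The Yetter-Drinfeld condition (X.h2)0 (x) h1 (X.h2)1 = X0.h1 (x) X1 h2. By
    [ev_mul_separated] it is tested on y, where both sides become
    A(h y) - A(h) y with A(h) = h1 X(h2). *)
Lemma coact_act X h :
  tsum (Δ h) (fun p q => tsum (δ (qts_act X q)) (fun Y d => Y ⊗ (p * d))) =
  tsum (Δ h) (fun p q => tsum (δ X) (fun Y d => qts_act Y p ⊗ (d * q))).
Proof.
apply: ev_mul_separated => y.
transitivity (tsum (Δ h) (fun p q => tsum (Δ y) (fun h1 h2 =>
    qts_ev (qts_act X q) h2 *: (p * h1)))).
  transitivity (tsum (Δ y) (fun h1 h2 => tsum (Δ h) (fun p q =>
      p * tsum (δ (qts_act X q)) (fun Y d => qts_ev Y h1 *: (d * h2))))).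
    apply: eq_tsum => h1 h2; rewrite tsum_tsum; last by lin.
    apply: eq_tsum => p q; rewrite tsum_tsum; last by lin.
    rewrite (lin_tsum (f := fun c => p * c)); last by lin.
    apply: eq_tsum => Y d; rewrite tsum_pure; last by lin.
    by rewrite -scalerAr mulrA.
  rewrite tsum_exchange; apply: eq_tsum => p q.
  rewrite -(lin_tsum (f := fun c => p * c)); last by lin.
  rewrite ev_coact_mul (lin_tsum (f := fun c => p * c)); last by lin.
  by apply: eq_tsum => h1 h2; rewrite scalerAr.
transitivity (tsum (Δ (h * y)) (fun a b => qts_ev X b *: a) -
   tsum (Δ h) (fun p q => qts_ev X q *: p) * y).
  rewrite swM; last by lin.
  rewrite (lin_tsum (f := fun c => c * y)); last by lin.
  rewrite -tsumB; apply: eq_tsum => p q.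
  rewrite -scalerAl.
  rewrite -(sw_counitr (T := fun a => qts_ev X q *: (p * a))); last by lin.
  rewrite -tsumB; apply: eq_tsum => a b.
  by rewrite ev_act scalerBl mulrC scalerA.
transitivity (tsum (Δ y) (fun h1 h2 => tsum (Δ h) (fun p q =>
    tsum (δ X) (fun Y d => qts_ev Y (p * h1) *: (d * (q * h2)))) -
  tsum (Δ h) (fun p q => tsum (δ X) (fun Y d =>
    ε h1 *: (qts_ev Y p *: (d * q * h2)))))); last first.
  apply: eq_tsum => h1 h2; rewrite tsum_tsum; last by lin.
  rewrite -tsumB; apply: eq_tsum => p q; rewrite tsum_tsum; last by lin.
  rewrite -tsumB; apply: eq_tsum => Y d; rewrite tsum_pure; last by lin.
  by rewrite ev_act scalerBl scalerA [ε h1 * _]mulrC mulrA.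
rewrite tsumB tsum_exchange -ev_coact_mul swM; last by lin.
congr (_ - _).
rewrite -ev_coact_mul (lin_tsum (f := fun c => c * y)); last by lin.
rewrite tsum_exchange; apply: eq_tsum => p q.
rewrite tsum_exchange (lin_tsum (f := fun c => c * y)); last by lin.
apply: eq_tsum => Y d.
rewrite (sw_counitl (T := fun h2 => qts_ev Y p *: (d * q * h2))); last by lin.
by rewrite -scalerAl.
Qed.

Lemma counit_anti h : ε (S h) = ε h.
Proof.
have := congr1 ε (hantil h); rewrite tliftE; last by lin.
rewrite linearZ /= hcounit1 mulr1 => <-.
rewrite -[in LHS](hcounitr h) tliftE; last by lin.
rewrite /tsum !linear_sum; apply: eq_bigr => p _.
by rewrite !linearZ /= hcounitM mulrC.
Qed.

(** Evaluated on h, both sides of coassociativity equal the sum of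
    X(h3) (h1 S(h5) (x) h2 S(h4)). *)
Lemma coact_comodule : comodule δ.
Proof.
have δl := coact_linear.
split=> // X.
  apply: ev_separated => h; rewrite tassocE !tsum_tmap //; try by lin.
  pose U h1 h2 h3 h4 h5 : tens H H := qts_ev X h3 *: ((h1 * S h5) ⊗ (h2 * S h4)).
  transitivity (tsum (Δ h) (fun h1 x => tsum (Δ x) (fun h2 y =>
    tsum (Δ y) (fun h3 z => tsum (Δ z) (fun h4 h5 => U h1 h2 h3 h4 h5))))).
    transitivity (tsum (δ X) (fun Y c => tsum (Δ h) (fun h1 x =>
        tsum (Δ x) (fun w h5 => qts_ev Y w *: ((h1 * S h5) ⊗ c))))).
      rewrite tsum_tsum; last by lin.
      apply: eq_tsum => Y c.
      transitivity (tsum (δ Y) (fun Y' c' => qts_ev Y' h *: c') ⊗ c).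
        rewrite tsum_tsum; last by lin.
        rewrite (lin_tsum (f := fun a => a ⊗ c)); last by lin.
        apply: eq_tsum => Y' c'; rewrite tsum_pure; last by lin.
        by rewrite (linear_scale _ _ ((tpure_bilin _ _).1 _)).
      rewrite ev_coact (lin_tsum (f := fun a => a ⊗ c)); last by lin.
      apply: eq_tsum => h1 x; rewrite (lin_tsum (f := fun a => a ⊗ c)); last by lin.
      apply: eq_tsum => w h5.
      by rewrite (linear_scale _ _ ((tpure_bilin _ _).1 _)).
    rewrite tsum_exchange; apply: eq_tsum => h1 x.
    transitivity (tsum (Δ x) (fun w h5 => tsum (Δ w) (fun h2 e =>
        tsum (Δ e) (fun h3 h4 => U h1 h2 h3 h4 h5)))).
      rewrite tsum_exchange; apply: eq_tsum => w h5.
      transitivity ((h1 * S h5) ⊗ tsum (δ X) (fun Y c => qts_ev Y w *: c)).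
        rewrite (lin_tsum (f := fun a => (h1 * S h5) ⊗ a)); last by lin.
        apply: eq_tsum => Y c.
        by rewrite (linear_scale _ _ ((tpure_bilin _ _).2 _)).
      rewrite ev_coact (lin_tsum (f := fun a => (h1 * S h5) ⊗ a)); last by lin.
      apply: eq_tsum => h2 e.
      rewrite (lin_tsum (f := fun a => (h1 * S h5) ⊗ a)); last by lin.
      apply: eq_tsum => h3 h4.
      by rewrite (linear_scale _ _ ((tpure_bilin _ _).2 _)).
    rewrite (sw_coassoc (T := fun h2 e h5 =>
      tsum (Δ e) (fun h3 h4 => U h1 h2 h3 h4 h5))); last by rewrite /U; lin.
    apply: eq_tsum => h2 y.
    by rewrite (sw_coassoc (T := fun h3 h4 h5 => U h1 h2 h3 h4 h5)) //; rewrite /U; lin.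
  transitivity (Δ (tsum (δ X) (fun Y c => qts_ev Y h *: c))); last first.
    by rewrite linear_sum; apply: eq_bigr => p _; rewrite linearZ.
  rewrite ev_coact.
  transitivity (tsum (Δ h) (fun h' z => tsum (Δ h') (fun h1 h2 =>
    tsum (Δ z) (fun h3 w => tsum (Δ w) (fun h4 h5 => U h1 h2 h3 h4 h5))))).
    rewrite (sw_coassoc (T := fun h1 h2 z => tsum (Δ z) (fun h3 w =>
      tsum (Δ w) (fun h4 h5 => U h1 h2 h3 h4 h5)))) //; rewrite /U; lin.
  rewrite (lin_tsum (f := Δ)); last by lin.
  apply: eq_tsum => h' z; rewrite tsum_exchange (lin_tsum (f := Δ)); last by lin.
  apply: eq_tsum => h3 w.
  rewrite linearZ /= -(tsum_tpure (Δ (h' * S w))) swM; last by lin.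
  rewrite (lin_tsum (f := fun a => qts_ev X h3 *: a)); last by lin.
  apply: eq_tsum => h1 h2; rewrite hcop_anti tsum_tsum; last by lin.
  rewrite (lin_tsum (f := fun a => qts_ev X h3 *: a)); last by lin.
  by apply: eq_tsum => h4 h5; rewrite tsum_pure //; lin.
apply: ev_ext => h; rewrite tliftE; last by lin.
transitivity (ε (tsum (δ X) (fun Y c => qts_ev Y h *: c))).
  rewrite /tsum evE !linear_sum; apply: eq_bigr => p _.
  by rewrite !linearZ /= mulrC.
rewrite ev_coact -[in RHS](hcounitl h) tliftE; last by lin.
rewrite /tsum !linear_sum; apply: eq_bigr => p _.
rewrite linearZ linear_sum /=.
rewrite -[in RHS](hcounitr p.2) tliftE; last by lin.
rewrite /tsum linear_sum mulr_sumr; apply: eq_bigr => q _.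
by rewrite !linearZ /= hcounitM counit_anti mulrC mulrA.
Qed.

End Coadjoint.
(** * The tangent space pulled back along the antipode *)

Section AntipodeStability.
Context (k : fieldType) (H : hopf_algebra k).
Local Notation Δ := (hcop H).
Local Notation ε := (hcounit H).
Local Notation S := (hanti H).

Section Module.
Context (V : vectType k) (act : V -> H -> V).
Hypothesis bilin_act : bilin act.
Hypothesis act_mul : forall v h h', act v (h * h') = act (act v h) h'.
Hypothesis act_1 : forall v, act v 1 = v.
Context (N : set V) (sN : subspace N).
Hypothesis N_anti : forall v h, N v -> N (act v (S h)).
Context (v : V) (Nv : N v).

(** In the space of linear maps from H to V, right convolution with the action
    is inverse to right convolution with the action composed with S. Starting
    from v eps, [anti_iter] applies the latter repeatedly; its values stay in N.
    The former takes v eps to the map h |-> v.h. *)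
Fixpoint anti_iter (j : nat) (x : H) : V :=
  if j is i.+1 then tsum (Δ x) (fun a b => act (anti_iter i a) (S b))
  else ε x *: v.

Lemma anti_iter_linear j : linear (anti_iter j).
Proof. by elim: j => [|j IHj]; rewrite /=; lin. Qed.

Lemma anti_iter_sub j x : N (anti_iter j x).
Proof.
elim: j x => [|j IHj] x /=; first exact: subspaceZ.
by apply: subspace_sum => // p _; apply: N_anti.
Qed.

Definition act_conv (f : H -> V) (x : H) : V :=
  tsum (Δ x) (fun a b => act (f a) b).

Lemma act_conv_linear f : linear f -> linear (act_conv f).
Proof. by move=> lf; rewrite /act_conv; lin. Qed.

Lemma act_conv0 x : act_conv (anti_iter 0) x = act v x.
Proof.
rewrite -[RHS](sw_counitl (T := fun b => act v b)); last by lin.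
by apply: eq_tsum => a b; rewrite /= (linear_scale _ _ (bilin_act.1 _)).
Qed.

Lemma act_convS j x : act_conv (anti_iter j.+1) x = anti_iter j x.
Proof.
have lj := anti_iter_linear j.
transitivity (tsum (Δ x) (fun a b => tsum (Δ a) (fun c d =>
    act (anti_iter j c) (S d * b)))).
  apply: eq_tsum => a b /=.
  rewrite (lin_tsum _ _ (bilin_act.1 b)).
  by apply: eq_tsum => c d; rewrite act_mul.
rewrite (sw_coassoc (T := fun c d b => act (anti_iter j c) (S d * b))); last by lin.
rewrite -[RHS](sw_counitr (T := anti_iter j)) //; apply: eq_tsum => c e.
rewrite (sw_antil (T := fun z => act (anti_iter j c) z)); last by lin.
by rewrite act_1.
Qed.

(** Linear dependence as seen by h: a finite-dimensional condition, as only the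
    values of f on the finitely many left legs of the coproduct of h enter. *)
Definition kills (h : H) (f : H -> V) := tsum (Δ h) (fun a b => f a ⊗ b) = 0.

Lemma kills_conv h f : linear f -> kills h f -> kills h (act_conv f).
Proof.
move=> lf hf; rewrite /kills.
transitivity (tsum (Δ h) (fun a b => tsum (Δ a) (fun c d => act (f c) d ⊗ b))).
  apply: eq_tsum => a b.
  by rewrite /act_conv (lin_tsum (f := fun w => w ⊗ b)) //; lin.
rewrite (sw_coassoc (T := fun c d b => act (f c) d ⊗ b)); last by lin.
transitivity (tsum (tsum (Δ h) (fun a b => f a ⊗ b))
    (fun w y => tsum (Δ y) (fun d b => act w d ⊗ b))); last first.
  by rewrite hf tsum0 //; lin.
rewrite tsum_tsum; last by lin.
by apply: eq_tsum => c y; rewrite tsum_pure //; lin.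
Qed.

Lemma kills_at h f : linear f -> kills h f -> f h = 0.
Proof.
move=> lf hf; rewrite -(sw_counitr (T := f)) //.
transitivity (tsum (tsum (Δ h) (fun a b => f a ⊗ b)) (fun w b => ε b *: w)).
  rewrite tsum_tsum; last by lin.
  by apply: eq_tsum => a b; rewrite tsum_pure //; lin.
by rewrite hf tsum0 //; lin.
Qed.

Definition iter_comb n (c : nat -> k) (x : H) : V :=
  \sum_(j < n) c j *: anti_iter j x.

Lemma iter_comb_linear n c : linear (iter_comb n c).
Proof.
move=> a x y; rewrite /iter_comb scaler_sumr -big_split; apply: eq_bigr => j _ /=.
by rewrite anti_iter_linear scalerDr !scalerA mulrC.
Qed.

Lemma act_conv_comb n c x : act_conv (iter_comb n.+1 c) x =
  c 0%N *: act v x + iter_comb n (fun j => c j.+1) x.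
Proof.
rewrite /iter_comb -act_conv0; under [in RHS]eq_bigr do rewrite -act_convS.
rewrite -(big_ord_recl n (fun j => c j *: act_conv (anti_iter j) x)).
rewrite /act_conv /tsum.
under [RHS]eq_bigr do rewrite scaler_sumr.
rewrite exchange_big; apply: eq_bigr => p _ /=.
rewrite (lin_big _ _ _ (bilin_act.1 _)); apply: eq_bigr => j _.
by rewrite (linear_scale _ _ (bilin_act.1 _)).
Qed.

(** Applying [act_conv] to a linear dependence lowers all the indices by one and
    turns the term of index 0 into a multiple of v.h. Once the lowest nonzero
    coefficient has reached index 0, the relation expresses v.h through values
    of [anti_iter], which lie in N. *)
Lemma comb_kills_sub h n c : kills h (iter_comb n c) ->
  (exists2 j, (j < n)%N & c j != 0) -> N (act v h).
Proof.
elim: n c => [|n IHn] c hc; first by case.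
have hc' := kills_conv (iter_comb_linear _ _) hc.
have [c0|c0] := eqVneq (c 0%N) 0 => -[j jn cj].
  case: j jn cj => [|j] jn cj; first by rewrite c0 eqxx in cj.
  apply: (IHn (fun j => c j.+1)); last by exists j.
  rewrite /kills -[RHS]hc'; apply: eq_tsum => a b.
  by rewrite act_conv_comb c0 scale0r add0r.
have := kills_at (act_conv_linear (iter_comb_linear _ _)) hc'.
rewrite act_conv_comb => /eqP; rewrite addr_eq0 => /eqP hv.
rewrite -[act v h]scale1r -(mulVf c0) -scalerA hv.
apply: subspaceZ => //; rewrite -scaleN1r; apply: subspaceZ => //.
by apply: subspace_sum => // i _; apply: subspaceZ => //; apply: anti_iter_sub.
Qed.

(** The iterates, restricted to the left legs of the coproduct of h, live in a
    finite-dimensional space, hence are linearly dependent. *)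
Lemma antipode_stable_sub h : N (act v h).
Proof.
pose q := size (tseq (Δ h)).
pose w (j : nat) : {ffun 'I_q -> V} :=
  [ffun l : 'I_q => anti_iter j (nth (0, 0) (tseq (Δ h)) l).1].
(* One index more than the dimension of the space that contains all w j. *)
pose m := (\dim (fullv : {vspace {ffun 'I_q -> V}})).+1.
pose X := [tuple w j | j < m].
have : ~~ free X.
  apply/negP; rewrite /free => /eqP dX.
  have := dimvS (subvf <<X>>%VS).
  by rewrite dX size_tuple ltnn.
move=> /freeP nfX.
have [c [cX [j cj]]] : exists c : 'I_m -> k,
    \sum_(i < m) c i *: X`_i = 0 /\ exists i, c i != 0.
  apply: contrapT => noc; apply: nfX => c cX i; apply: contrapT => /eqP ci.
  by apply: noc; exists c; split=> //; exists i.
pose d (i : nat) : k := if insub i is Some i' then c i' else 0.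
have dE (i : 'I_m) : d i = c i by rewrite /d valK.
apply: (@comb_kills_sub h m d); last by exists j; rewrite ?dE.
rewrite /kills /tsum (big_nth (0, 0)) big_mkord big1 // => l _.
suff -> : iter_comb m d (nth (0, 0) (tseq (Δ h)) l).1 = 0.
  exact: (lin0 ((tpure_bilin V H).1 _)).
transitivity ((\sum_(i < m) c i *: X`_i) l); last by rewrite cX ffunE.
rewrite sum_ffunE; apply: eq_bigr => i _.
by rewrite ffunE -tnth_nth tnth_mktuple ffunE dE.
Qed.

End Module.

(** The functionals killed by composition with S form a subspace that is stable
    under the action of the image of S, hence under the action of H. Then
    X(h) = - (X.h1)(S(h2)) vanishes. *)
Lemma ev_anti_inj (g : quantum_tangent_space H) (X : g) :
  (forall h, qts_ev X (S h) = 0) -> X = 0.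
Proof.
move=> X0; pose N : set g := [set Y | forall h, qts_ev Y (S h) = 0].
have sN : subspace N.
  split=> [h|a Y Z NY NZ h]; first exact: ev0.
  by rewrite evD evZ NY NZ mulr0 addr0.
have N_anti Y h : N Y -> N (qts_act Y (S h)).
  by move=> NY y; rewrite ev_act -antiM !NY mul0r subr0.
have NX h : N (qts_act X h).
  exact: (antipode_stable_sub (bilin_act g) (@act_mul _ _ g) (@act1 _ _ g) sN
    N_anti X0).
apply: ev_ext => h; rewrite ev0.
have evl : linear (qts_ev X : H -> k^o) by move=> a x y; exact: linearP.
have : tsum (Δ h) (fun a b => qts_ev (qts_act X a) (S b) : k^o) = 0.
  by rewrite /tsum big1 // => p _; apply: NX.
have -> : (fun a b => qts_ev (qts_act X a) (S b) : k^o) =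
    (fun a b => (qts_ev X (a * S b) : k^o) - ε b *: (qts_ev X a : k^o)).
  apply/funext => a; apply/funext => b.
  by rewrite ev_act counit_anti [_ * ε b]mulrC.
rewrite tsumB (sw_antir (T := qts_ev X : H -> k^o)) //.
rewrite (sw_counitr (T := qts_ev X : H -> k^o)) // qts_augmentation scaler0.
by rewrite sub0r => /eqP; rewrite oppr_eq0 => /eqP.
Qed.

End AntipodeStability.
(** * Vector fields on a comodule algebra *)

Section VectorFields.
Context (k : fieldType) (H : hopf_algebra k) (g : bicovariant_qts H).
Local Notation Δ := (hcop H).
Local Notation ε := (hcounit H).
Local Notation S := (hanti H).
Local Notation δ := (@qts_coact k H g).

Section Operations.
Context (A : ualgType k) (r : A -> tens A H).

Definition std_l (f : A) (x : tens A g) : tens A g :=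
  tsum x (fun a X => (f ∙ a) ⊗ X).

Definition std_r (x : tens A g) (f : A) : tens A g :=
  tsum x (fun a X => tsum (r f) (fun f0 f1 => (a ∙ f0) ⊗ qts_act X f1)).

Definition std_coact (x : tens A g) : tens (tens A g) H :=
  tsum x (fun a X => tsum (r a) (fun a0 a1 => tsum (δ X) (fun Y c =>
    (a0 ⊗ Y) ⊗ (a1 * c)))).

Definition std_app (x : tens A g) (f : A) : A :=
  tsum x (fun a X => tsum (r f) (fun f0 f1 => qts_ev X f1 *: (a ∙ f0))).

Hypothesis r_alg : comodule_algebra r.

Lemma calg_comodule : comodule r.
Proof. by case: r_alg. Qed.
Local Notation rC := calg_comodule.

Lemma calg_linear : linear r.
Proof. exact: comodule_linear rC. Qed.
Let δl : linear δ := @coact_linear k H g.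
Let rl : linear r := calg_linear.

Lemma calg_coactM (Z : lmodType k) (T : A -> H -> Z) a a' : bilin T ->
  tsum (r (a ∙ a')) T =
  tsum (r a) (fun a0 a1 => tsum (r a') (fun b0 b1 => T (a0 ∙ b0) (a1 * b1))).
Proof.
move=> bT; have [_ _ ->] := r_alg; rewrite tprodE; last by lin.
rewrite tsum_tsum //; apply: eq_tsum => a0 a1; rewrite tsum_tsum //.
by apply: eq_tsum => b0 b1; rewrite tsum_pure.
Qed.

Lemma calg_coact1 (Z : lmodType k) (T : A -> H -> Z) : bilin T ->
  tsum (r uone) T = T uone 1.
Proof. by move=> bT; have [_ -> _] := r_alg; rewrite tsum_pure. Qed.

Lemma bilin_std_l : bilin std_l.
Proof. by rewrite /std_l; lin. Qed.
Lemma bilin_std_r : bilin std_r.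
Proof. by rewrite /std_r; lin. Qed.
Lemma bilin_std_app : bilin std_app.
Proof. by rewrite /std_app; lin. Qed.
Lemma std_coact_linear : is_linear _ _ std_coact.
Proof. by rewrite /std_coact; lin. Qed.

Lemma std_l_pure f a (X : g) : std_l f (a ⊗ X) = (f ∙ a) ⊗ X.
Proof. by rewrite /std_l tsum_pure //; lin. Qed.
Lemma std_r_pure f a (X : g) : std_r (a ⊗ X) f =
  tsum (r f) (fun f0 f1 => (a ∙ f0) ⊗ qts_act X f1).
Proof. by rewrite /std_r tsum_pure //; lin. Qed.
Lemma std_app_pure f a (X : g) : std_app (a ⊗ X) f =
  tsum (r f) (fun f0 f1 => qts_ev X f1 *: (a ∙ f0)).
Proof. by rewrite /std_app tsum_pure //; lin. Qed.
Lemma std_coact_pure a (X : g) : std_coact (a ⊗ X) =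
  tsum (r a) (fun a0 a1 => tsum (δ X) (fun Y c => (a0 ⊗ Y) ⊗ (a1 * c))).
Proof. by rewrite /std_coact tsum_pure //; lin. Qed.

Let bl := bilin_std_l.
Let br := bilin_std_r.
Let bapp := bilin_std_app.
Let lD : linear std_coact := std_coact_linear.

Lemma std_l1 x : std_l uone x = x.
Proof.
move: x; apply: tens_linear_ext; [by lin|by lin|move=> a X].
by rewrite std_l_pure umul1l.
Qed.

Lemma std_lM f f' x : std_l (f ∙ f') x = std_l f (std_l f' x).
Proof.
move: x; apply: tens_linear_ext; [by lin|by lin|move=> a X].
by rewrite !std_l_pure umulA.
Qed.

Lemma std_r1 x : std_r x uone = x.
Proof.
move: x; apply: tens_linear_ext; [by lin|by lin|move=> a X].
by rewrite std_r_pure calg_coact1 ?umul1r ?act1 //; lin.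
Qed.

Lemma std_rM x f f' : std_r x (f ∙ f') = std_r (std_r x f) f'.
Proof.
move: x; apply: tens_linear_ext; [by lin|by lin|move=> a X].
rewrite !std_r_pure calg_coactM; last by lin.
rewrite (lin_tsum _ _ (br.1 f')); apply: eq_tsum => f0 f1.
rewrite std_r_pure; apply: eq_tsum => g0 g1.
by rewrite umulA act_mul.
Qed.

Lemma std_lr f x f' : std_r (std_l f x) f' = std_l f (std_r x f').
Proof.
move: x; apply: tens_linear_ext; [by lin|by lin|move=> a X].
rewrite std_l_pure !std_r_pure (lin_tsum _ _ (bl.2 f)).
by apply: eq_tsum => f0 f1; rewrite std_l_pure umulA.
Qed.

Lemma std_app_l f x f' : std_app (std_l f x) f' = f ∙ std_app x f'.
Proof.
move: x; apply: tens_linear_ext; [by lin|by lin|move=> a X].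
rewrite std_l_pure !std_app_pure (lin_tsum _ _ (umul_linr f)).
by apply: eq_tsum => f0 f1; rewrite (linear_scale _ _ (umul_linr f)) umulA.
Qed.

Lemma std_app_leibniz x f f' :
  std_app x (f ∙ f') = std_app x f ∙ f' + std_app (std_r x f) f'.
Proof.
move: x; apply: tens_linear_ext; [by lin|by lin|move=> a X].
rewrite std_r_pure !std_app_pure calg_coactM; last by lin.
rewrite (lin_tsum _ _ (umul_linl f')) (lin_tsum _ _ (bapp.1 f')) -tsumD.
apply: eq_tsum => f0 f1; rewrite std_app_pure.
rewrite -[in RHS](coact_counit rC (T := fun g0 => (qts_ev X f1 *: (a ∙ f0)) ∙ g0));
  last by lin.
rewrite -tsumD; apply: eq_tsum => g0 g1.
rewrite ev_act scalerBl (linear_scale _ _ (umul_linl g0)) scalerA.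
by rewrite [ε g1 * _]mulrC addrC subrK umulA.
Qed.

Lemma std_comodule : comodule std_coact.
Proof.
have gC := coact_comodule g.
split=> [|x|x]; first exact: std_coact_linear.
  rewrite tassocE tsum_tmap //; try by lin.
  rewrite [RHS]tmapE; [|by lin|by lin].
  move: x; apply: tens_linear_ext; [by lin|by lin|move=> a X].
  rewrite std_coact_pure.
  pose U a00 a01 a1 (Y0 : g) c0 c : tens (tens A g) (tens H H) :=
    (a00 ⊗ Y0) ⊗ ((a01 * c0) ⊗ (a1 * c)).
  transitivity (tsum (r a) (fun a0 a1 => tsum (r a0) (fun a00 a01 =>
    tsum (δ X) (fun Y c => tsum (δ Y) (fun Y0 c0 => U a00 a01 a1 Y0 c0 c))))).
    rewrite tsum_tsum; last by lin.
    apply: eq_tsum => a0 a1; rewrite tsum_tsum; last by lin.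
    rewrite [RHS]tsum_exchange; apply: eq_tsum => Y c.
    rewrite tsum_pure; last by lin.
    rewrite std_coact_pure tsum_tsum; last by lin.
    apply: eq_tsum => a00 a01; rewrite tsum_tsum; last by lin.
    by apply: eq_tsum => Y0 c0; rewrite tsum_pure //; lin.
  rewrite (coact_coassoc rC (T := fun a00 a01 a1 => tsum (δ X) (fun Y c =>
    tsum (δ Y) (fun Y0 c0 => U a00 a01 a1 Y0 c0 c)))); last by rewrite /U; lin.
  rewrite tsum_tsum; last by lin.
  apply: eq_tsum => a0 a1; rewrite tsum_tsum; last by lin.
  transitivity (tsum (Δ a1) (fun p q => tsum (δ X) (fun Y c =>
      tsum (Δ c) (fun s t => U a0 p q Y s t)))).
    apply: eq_tsum => p q.
    by rewrite (coact_coassoc gC (T := fun Y0 c0 c => U a0 p q Y0 c0 c)) //;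
      rewrite /U; lin.
  rewrite tsum_exchange; apply: eq_tsum => Y c; rewrite tsum_pure; last by lin.
  rewrite -(tsum_tpure (Δ (a1 * c))) swM; last by lin.
  rewrite (lin_tsum (f := fun w => (a0 ⊗ Y) ⊗ w)); last by lin.
  apply: eq_tsum => p q; rewrite (lin_tsum (f := fun w => (a0 ⊗ Y) ⊗ w)) //.
  by lin.
rewrite tliftE; last by lin.
move: x; apply: tens_linear_ext; [by lin|by lin|move=> a X].
rewrite std_coact_pure tsum_tsum; last by lin.
rewrite -[RHS](coact_counit rC (T := fun a0 => a0 ⊗ X)); last by lin.
apply: eq_tsum => a0 a1; rewrite tsum_tsum; last by lin.
rewrite -(coact_counit gC (T := fun Y => a0 ⊗ Y)); last by lin.
rewrite (lin_tsum (f := fun w => ε a1 *: w)); last by lin.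
apply: eq_tsum => Y c; rewrite tsum_pure; last by lin.
by rewrite hcounitM scalerA.
Qed.

(** The Yetter-Drinfeld condition is what makes the right multiplication
    colinear. *)
Lemma std_covariant f x f' : std_coact (std_r (std_l f x) f') =
  tprod std_r (tprod std_l (r f) (std_coact x)) (r f').
Proof.
rewrite !tprodE //.
move: x; apply: tens_linear_ext.
- by lin.
- by lin.
move=> a X; rewrite std_l_pure std_r_pure.
pose U f0 f1 a0 a1 k0 p (Y : g) d : tens (tens A g) H :=
  ((f0 ∙ a0) ∙ k0 ⊗ Y) ⊗ (f1 * a1 * (p * d)).
transitivity (tsum (r f) (fun f0 f1 => tsum (r a) (fun a0 a1 =>
  tsum (r f') (fun k0 k1 => tsum (Δ k1) (fun p q =>
  tsum (δ (qts_act X q)) (fun Y d => U f0 f1 a0 a1 k0 p Y d)))))).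
  rewrite (lin_tsum _ _ lD).
  transitivity (tsum (r f') (fun k0 k1 => tsum (r f) (fun f0 f1 =>
    tsum (r a) (fun a0 a1 => tsum (r k0) (fun k00 k01 =>
    tsum (δ (qts_act X k1)) (fun Y d => U f0 f1 a0 a1 k00 k01 Y d)))))).
    apply: eq_tsum => k0 k1; rewrite std_coact_pure calg_coactM; last by lin.
    rewrite calg_coactM; last by lin.
    apply: eq_tsum => f0 f1; apply: eq_tsum => a0 a1; apply: eq_tsum => k00 k01.
    by apply: eq_tsum => Y d; rewrite /U !mulrA.
  rewrite tsum_exchange; apply: eq_tsum => f0 f1.
  rewrite tsum_exchange; apply: eq_tsum => a0 a1.
  by rewrite (coact_coassoc rC (T := fun k00 k01 k1 =>
    tsum (δ (qts_act X k1)) (fun Y d => U f0 f1 a0 a1 k00 k01 Y d))) // /U; lin.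
rewrite tsum_tsum; last by lin.
apply: eq_tsum => f0 f1; rewrite tsum_tsum; last by lin.
rewrite std_coact_pure tsum_tsum; last by lin.
apply: eq_tsum => a0 a1; rewrite tsum_tsum; last by lin.
transitivity (tsum (r f') (fun k0 k1 => tsum (δ X) (fun Y d =>
    tsum (r k0) (fun k00 k01 =>
      (((f0 ∙ a0) ∙ k00) ⊗ qts_act Y k01) ⊗ (f1 * a1 * (d * k1)))))); last first.
  rewrite tsum_exchange; apply: eq_tsum => Y d.
  rewrite tsum_pure; last by lin.
  rewrite tsum_pure; last by lin.
  apply: eq_tsum => k0 k1; rewrite std_l_pure std_r_pure.
  rewrite (lin_tsum (f := fun w => w ⊗ (f1 * (a1 * d) * k1))); last by lin.
  by apply: eq_tsum => k00 k01; rewrite !mulrA.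
transitivity (tsum (r f') (fun k0 k1 => tsum (r k0) (fun k00 k01 =>
   tsum (δ X) (fun Y d =>
      (((f0 ∙ a0) ∙ k00) ⊗ qts_act Y k01) ⊗ (f1 * a1 * (d * k1)))))); last first.
  by apply: eq_tsum => k0 k1; rewrite tsum_exchange.
rewrite (coact_coassoc rC (T := fun k00 k01 k1 => tsum (δ X) (fun Y d =>
      (((f0 ∙ a0) ∙ k00) ⊗ qts_act Y k01) ⊗ (f1 * a1 * (d * k1))))); last by lin.
apply: eq_tsum => k0 k1.
pose G (t : tens g H) : tens (tens A g) H :=
  tsum t (fun Y d => (((f0 ∙ a0) ∙ k0) ⊗ Y) ⊗ (f1 * a1 * d)).
have lG : is_linear _ _ G by rewrite /G; lin.
have := congr1 G (coact_act X k1); rewrite !(lin_tsum _ _ lG) => GE.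
transitivity (tsum (Δ k1) (fun p q =>
    G (tsum (δ (qts_act X q)) (fun Y d => Y ⊗ (p * d))))).
  apply: eq_tsum => p q; rewrite (lin_tsum _ _ lG); apply: eq_tsum => Y d.
  by rewrite /G tsum_pure //; lin.
rewrite GE; apply: eq_tsum => p q.
rewrite (lin_tsum _ _ lG); apply: eq_tsum => Y d.
by rewrite /G tsum_pure //; lin.
Qed.

(** This is [ev_coact_mul] applied to the leg f1 of the coaction of f. *)
Lemma std_app_colinear :
  colinear (diag_coact std_coact r) r (tlift std_app).
Proof.
apply/colinear_diagP => // x f.
move: x; apply: tens_linear_ext; [by lin|by lin|move=> a X].
rewrite std_app_pure std_coact_pure tsum_tsum; last by lin.
pose U (a0 : A) (a1 : H) u v f1 : tens A H := qts_ev X f1 *: ((a0 ∙ u) ⊗ (a1 * v)).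
transitivity (tsum (r a) (fun a0 a1 => tsum (r f) (fun f0 f1 =>
    tsum (r f0) (fun u v => U a0 a1 u v f1)))).
  rewrite (lin_tsum _ _ rl) tsum_exchange; apply: eq_tsum => f0 f1.
  rewrite (linear_scale _ _ rl) -(tsum_tpure (r (a ∙ f0))) calg_coactM; last by lin.
  rewrite (lin_tsum (f := fun w => qts_ev X f1 *: w)); last by lin.
  apply: eq_tsum => a0 a1.
  by rewrite (lin_tsum (f := fun w => qts_ev X f1 *: w)) //; lin.
apply: eq_tsum => a0 a1.
rewrite (coact_coassoc rC (T := U a0 a1)); last by rewrite /U; lin.
rewrite tsum_tsum; last by lin.
transitivity (tsum (r f) (fun f0 f1 => tsum (r f0) (fun u v =>
  tsum (δ X) (fun Y c => qts_ev Y v *: ((a0 ∙ u) ⊗ (a1 * (c * f1))))))); last first.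
  under eq_tsum => f0 f1 do rewrite tsum_exchange.
  rewrite tsum_exchange; apply: eq_tsum => Y c; rewrite tsum_pure; last by lin.
  apply: eq_tsum => f0 f1; rewrite std_app_pure.
  rewrite (lin_tsum (f := fun w => w ⊗ (a1 * c * f1))); last by lin.
  apply: eq_tsum => u v; rewrite mulrA.
  by rewrite (linear_scale _ _ ((tpure_bilin _ _).1 _)).
rewrite (coact_coassoc rC (T := fun u v f1 => tsum (δ X) (fun Y c =>
  qts_ev Y v *: ((a0 ∙ u) ⊗ (a1 * (c * f1)))))); last by lin.
apply: eq_tsum => u w.
pose G (z : H) : tens A H := (a0 ∙ u) ⊗ (a1 * z).
have lG : linear G by rewrite /G; lin.
transitivity (G (tsum (Δ w) (fun v f1 => qts_ev X f1 *: v))).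
  rewrite (lin_tsum _ _ lG); apply: eq_tsum => v f1.
  by rewrite (linear_scale _ _ lG).
rewrite -ev_coact_mul (lin_tsum _ _ lG); apply: eq_tsum => v f1.
rewrite (lin_tsum _ _ lG); apply: eq_tsum => Y c.
by rewrite (linear_scale _ _ lG).
Qed.

(** The map F below is z = b (x) c |-> sum f_i b0 X_i(b1 S(c)). On 1 (x) h it
    gives sum X_i(S(h)) f_i, while on an element sum a a'0 (x) a'1 of the image
    of the canonical map it gives sum L_x(a) a', which is zero. *)
Lemma std_app_faithful x :
  (forall h, exists t : tens A A,
     tsum t (fun a a' => tsum (r a') (fun a0 a1 => (a ∙ a0) ⊗ a1)) = uone ⊗ h) ->
  (forall f, std_app x f = 0) -> x = 0.
Proof.
move=> gal x0.
apply: (@tens_separated_family _ _ _ _ (fun h : H => evat (S h))) => [X X0|h].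
  exact: ev_anti_inj.
have [t th] := gal h.
pose F (z : tens A H) : A := tsum z (fun b c => tsum (r b) (fun b0 b1 =>
  tsum x (fun a X => qts_ev X (b1 * S c) *: (a ∙ b0)))).
have lF : is_linear _ _ F by rewrite /F; lin.
transitivity (F (uone ⊗ h)).
  rewrite /F tsum_pure ?calg_coact1; [|by lin|by lin].
  by apply: eq_tsum => a X; rewrite mul1r umul1r.
rewrite -th (lin_tsum _ _ lF).
transitivity (tsum t (fun a a' => std_app x a ∙ a')); last first.
  by rewrite /tsum big1 // => p _; rewrite x0 (lin0 (umul_linl _)).
apply: eq_tsum => a a'.
transitivity (tsum (r a) (fun c0 c1 => tsum (r a') (fun a0 a1 =>
  tsum (r a0) (fun d0 d1 => tsum x (fun f X =>
    qts_ev X (c1 * (d1 * S a1)) *: (f ∙ (c0 ∙ d0))))))).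
  rewrite (lin_tsum _ _ lF) tsum_exchange; apply: eq_tsum => a0 a1.
  rewrite /F tsum_pure; last by lin.
  rewrite calg_coactM; last by lin.
  apply: eq_tsum => c0 c1; apply: eq_tsum => d0 d1; apply: eq_tsum => f X.
  by rewrite mulrA.
rewrite /std_app [X in _ = X ∙ _]tsum_exchange (lin_tsum _ _ (umul_linl a')).
apply: eq_tsum => c0 c1.
rewrite (coact_coassoc rC (T := fun d0 d1 a1 => tsum x (fun f X =>
    qts_ev X (c1 * (d1 * S a1)) *: (f ∙ (c0 ∙ d0))))); last by lin.
rewrite -(coact_counit rC (T := fun d0 =>
  tsum x (fun f X => qts_ev X c1 *: (f ∙ c0)) ∙ d0)); last by lin.
apply: eq_tsum => d0 w.
rewrite tsum_exchange (lin_tsum _ _ (umul_linl d0)).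
rewrite (lin_tsum (f := fun z => ε w *: z)); last by lin.
apply: eq_tsum => f X.
rewrite (sw_antir (T := fun z => qts_ev X (c1 * z) *: (f ∙ (c0 ∙ d0)))); last by lin.
by rewrite mulr1 (linear_scale _ _ (umul_linl d0)) umulA.
Qed.

End Operations.
End VectorFields.
(** * The sheaf of vector fields *)

Section Naturality.
Context (k : fieldType) (H : hopf_algebra k) (g : bicovariant_qts H).
Context (A A' : ualgType k) (r : A -> tens A H) (r' : A' -> tens A' H).
Hypothesis r_alg : comodule_algebra r.
Hypothesis r'_alg : comodule_algebra r'.
Context (phi : A -> A').
Hypothesis phi_linear : linear phi.
Hypothesis phiM : forall a b, phi (a ∙ b) = phi a ∙ phi b.
Hypothesis phi_coact : forall a, r' (phi a) = tmap phi id (r a).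

Let rl : linear r := calg_linear r_alg.
Let r'l : linear r' := calg_linear r'_alg.
Let δl : linear (@qts_coact k H g) := @coact_linear k H g.
Local Notation m := (tmap phi (id : g -> g)).
Let lm : is_linear (tens A g) (tens A' g) m.
Proof. by apply: linear_tmap => //; lin. Qed.
Let bl := bilin_std_l g A.
Let bl' := bilin_std_l g A'.
Let br := bilin_std_r g r_alg.
Let br' := bilin_std_r g r'_alg.
Let ba := bilin_std_app g r_alg.
Let ba' := bilin_std_app g r'_alg.

Lemma std_l_nat f x : m (std_l f x) = std_l (phi f) (m x).
Proof.
have lm' := lm; rewrite /is_linear in lm'.
move: x; apply: tens_linear_ext; [by lin|by lin|move=> a X].
by rewrite std_l_pure !tmap_pure // std_l_pure phiM.
Qed.

Lemma std_r_nat x f : m (std_r r x f) = std_r r' (m x) (phi f).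
Proof.
have lm' := lm; rewrite /is_linear in lm'.
move: x; apply: tens_linear_ext; [by lin|by lin|move=> a X].
rewrite tmap_pure // !std_r_pure // phi_coact tsum_tmap //; try by lin.
rewrite (lin_tsum _ _ lm); apply: eq_tsum => f0 f1.
by rewrite tmap_pure // phiM.
Qed.

Lemma std_app_nat x f : phi (std_app r x f) = std_app r' (m x) (phi f).
Proof.
have lm' := lm; rewrite /is_linear in lm'.
move: x; apply: tens_linear_ext; [by lin|by lin|move=> a X].
rewrite tmap_pure // !std_app_pure // phi_coact tsum_tmap //; try by lin.
rewrite (lin_tsum _ _ phi_linear); apply: eq_tsum => f0 f1.
by rewrite (linear_scale _ _ phi_linear) phiM.
Qed.

Lemma std_coact_nat x : std_coact r' (m x) = tmap m id (std_coact r x).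
Proof.
have lm' := lm; rewrite /is_linear in lm'.
have lD : linear (std_coact r : tens A g -> _) := @std_coact_linear k H g A r r_alg.
have lD' : linear (std_coact r' : tens A' g -> _) := @std_coact_linear k H g A' r' r'_alg.
rewrite [RHS]tmapE; [|by lin|by lin].
move: x; apply: tens_linear_ext; [by lin|by lin|move=> a X].
rewrite tmap_pure // !std_coact_pure // phi_coact tsum_tmap //; try by lin.
rewrite tsum_tsum; last by lin.
apply: eq_tsum => a0 a1; rewrite tsum_tsum; last by lin.
by apply: eq_tsum => Y c; rewrite tsum_pure ?tmap_pure //; lin.
Qed.

End Naturality.

Lemma cover_sub (X : topologicalType) (J : Type) (V : J -> opens X) (U : opens X) :
  oset U = \bigcup_j V j -> forall j, V j `<=` U.
Proof. by move=> -> j x Vx; exists j. Qed.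

Lemma sheaf_separated (k : fieldType) (X : topologicalType) (P : presheaf k X)
    (J : Type) (V : J -> opens X) (U : opens X) :
  is_sheaf P -> oset U = \bigcup_j V j ->
  forall x y : P U, (forall j (p : V j `<=` U), pres p x = pres p y) -> x = y.
Proof.
move=> Psh UE x y xy; have Vs := cover_sub UE.
have [i j W p q|t [_ tU]] := Psh J V U UE (fun j => pres (Vs j) y).
  have WU : W `<=` U by apply: subset_trans (Vs i).
  by rewrite !(pres_comp _ _ WU).
have yE j (p : V j `<=` U) : pres p y = pres (Vs j) y.
  by rewrite (Prop_irrelevance p (Vs j)).
by rewrite -(tU x) 1?(tU y) // => j p; rewrite -yE // xy.
Qed.

Lemma hom_sec_ext (k : fieldType) (X : topologicalType) (P Q : presheaf k X)
    (U : opens X) (f f' : hom_sec P Q U) :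
  (forall (V : opens X) (p : V `<=` U) s, hfun f p s = hfun f' p s) -> f = f'.
Proof.
case: f f' => [f fl fn] [f' fl' fn'] /= ff'.
have E : f = f'.
  apply: functional_extensionality_dep => V; apply: functional_extensionality_dep => p.
  by apply/funext => s; apply: ff'.
by subst f'; congr HomSec; apply: Prop_irrelevance.
Qed.

Section StandardCalculus.
Context (k : fieldType) (H : hopf_algebra k) (g : bicovariant_qts H).
Context (X : topologicalType) (F : comodule_algebra_sheaf H X).
Local Notation r := (@cas_coact k H X F _).
Let rA U : comodule_algebra (@cas_coact k H X F U) := cas_comodule_algebra F U.

Lemma ares_linear (U V : opens X) (p : V `<=` U) : linear (@ares _ _ F U V p).
Proof. exact: linearP. Qed.

Definition std_res (U V : opens X) (p : V `<=` U) :
  tens (F U) g -> tens (F V) g := tmap (ares p) id.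

Lemma std_res_linear (U V : opens X) (p : V `<=` U) :
  is_linear (tens (F U) g) (tens (F V) g) (std_res p).
Proof. by apply: linear_tmap; lin. Qed.

HB.instance Definition _ (U V : opens X) (p : V `<=` U) :=
  GRing.isLinear.Build k (tens (F U) g) (tens (F V) g) _ (std_res p)
    (std_res_linear p).

Lemma std_resE (U V : opens X) (p : V `<=` U) t :
  std_res p t = tsum t (fun f Y => ares p f ⊗ Y).
Proof. by rewrite /std_res tmapE //; lin. Qed.

Lemma std_res_id (U : opens X) (p : U `<=` U) t : std_res p t = t.
Proof.
rewrite std_resE -[RHS]tsum_tpure.
by apply: eq_tsum => f Y; rewrite ares_id.
Qed.

Lemma std_res_comp (U V W : opens X) (p : V `<=` U) (q : W `<=` V)
  (pq : W `<=` U) t : std_res q (std_res p t) = std_res pq t.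
Proof.
rewrite !std_resE tsum_tsum; last by lin.
apply: eq_tsum => f Y; rewrite tsum_pure ?(ares_comp _ _ pq) //; lin.
Qed.

Definition std_presheaf : presheaf k X :=
  @Presheaf k X (fun U => tens (F U) g) (fun U V p => std_res p)
    std_res_id std_res_comp.

Local Notation b := (vbasis (fullv : {vspace g})).
Local Notation F_ := (alg_to_presheaf F).

(** The components on the chosen basis of g identify F(U) (x) g with a finite
    power of F(U), so that sections are glued componentwise. *)
Definition std_coord (U : opens X) (t : tens (F U) g) i : F U :=
  tsum t (fun f Y => coord b i Y *: f).

Lemma std_coordE U (t : tens (F U) g) : t = \sum_i std_coord t i ⊗ b`_i.
Proof.
move: t; apply: tens_linear_ext => [||f Y].
- by lin.
- move=> a x y; rewrite scaler_sumr -big_split; apply: eq_bigr => i _ /=.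
  rewrite /std_coord tsum_linear; last by lin.
  by rewrite (tpure_bilin _ _).1.
rewrite {1}(coord_vbasis (memvf Y)) (lin_big _ _ _ ((tpure_bilin _ _).2 _)).
apply: eq_bigr => i _; rewrite /std_coord tsum_pure; last by lin.
rewrite (linear_scale _ _ ((tpure_bilin _ _).1 _)).
by rewrite (linear_scale _ _ ((tpure_bilin _ _).2 _)).
Qed.

Lemma std_coord_res (U V : opens X) (p : V `<=` U) t i :
  std_coord (std_res p t) i = ares p (std_coord t i).
Proof.
rewrite std_resE /std_coord tsum_tsum; last by lin.
rewrite (lin_tsum _ _ (ares_linear p)); apply: eq_tsum => f Y.
by rewrite tsum_pure ?linearZ //; lin.
Qed.

Lemma std_coord_sum U (c : 'I_(\dim (fullv : {vspace g})) -> F U) i :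
  std_coord (\sum_j c j ⊗ b`_j) i = c i.
Proof.
rewrite /std_coord (lin_big (f := fun t => tsum t (fun f Y => coord b i Y *: f)));
  last by lin.
rewrite (bigD1 i) //= big1 => [|j ji]; rewrite tsum_pure; try by lin.
  by rewrite coord_free ?(basis_free (vbasisP _)) // eqxx scale1r addr0.
rewrite coord_free ?(basis_free (vbasisP _)) //.
by rewrite (negbTE ji) scale0r.
Qed.

Lemma std_is_sheaf : is_sheaf std_presheaf.
Proof.
move=> J V U UE s sE; have Vs := cover_sub UE.
have glue i : exists u : F_ U, forall j (p : V j `<=` U),
    pres p u = std_coord (s j : tens (F (V j)) g) i.
  have [j j' W p q|u [uP _]] := cas_is_sheaf UE
      (s := fun j => std_coord (s j : tens (F (V j)) g) i : F_ (V j)).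
    by rewrite /= -!std_coord_res; congr (std_coord _ i); apply: sE.
  by exists u.
pose c i := projT1 (cid (glue i)).
have cP i j (p : V j `<=` U) : ares p (c i) = std_coord (s j : tens (F (V j)) g) i.
  by rewrite /c; case: cid => u /= /(_ j p).
exists (\sum_i c i ⊗ b`_i); split=> [j p|t tP] /=.
  rewrite [LHS]std_coordE [RHS]std_coordE; apply: eq_bigr => i _.
  by rewrite std_coord_res std_coord_sum cP.
rewrite [RHS]std_coordE; apply: eq_bigr => i _; congr (_ ⊗ _).
apply: (sheaf_separated (@cas_is_sheaf _ _ _ F) UE) => j p.
by rewrite /= cP -(tP j p) std_coord_res.
Qed.

Definition std_hom (U : opens X) (x : tens (F U) g) : hom_sec F_ F_ U.
Proof.
refine (@HomSec k X F_ F_ U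
  (fun V p (s : F V) => std_app (@cas_coact k H X F V) (std_res p x) s) _ _).
- move=> V p; exact: (bilin_std_app g (rA V)).2.
- move=> V W p q r s /=.
  rewrite (std_app_nat (rA V) (rA W)); last 3 first.
  + exact: ares_linear.
  + exact: aresM.
  + exact: cas_nat.
  by rewrite -/(std_res r _) (std_res_comp _ _ q).
Defined.

Lemma std_precalculus_subproof (U V : opens X) (p : V `<=` U) (f : F V) :
  linear (fun x : std_presheaf U => hfun (std_hom x) p f).
Proof.
move=> a x y /=; rewrite std_res_linear.
by rewrite (bilin_std_app g (rA V)).1.
Qed.

Definition std_calculus : precalculus F.
Proof.
refine (@Precalculus k H X F std_presheaf std_is_sheaf
  (fun U f x => std_l f x) (fun U x f => std_r (@cas_coact k H X F U) x f)
  (fun U x => std_coact (@cas_coact k H X F U) x) std_hom _ _ _ _ _ _ _ _).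
- move=> U; exact: (bilin_std_l g (F U)).
- move=> U; exact: (bilin_std_r g (rA U)).
- move=> U; exact: (@std_coact_linear k H g (F U) _ (rA U)).
- exact: std_precalculus_subproof.
- by move=> U V p f x; apply: std_l_nat; [exact: ares_linear|exact: aresM].
- move=> U V p x f; apply: std_r_nat; [exact: rA|exact: rA|exact: ares_linear| |].
    exact: aresM.
  exact: cas_nat.
- move=> U V p x; apply: std_coact_nat; [exact: rA|exact: rA|exact: ares_linear|].
  exact: cas_nat.
- move=> U V p x; apply: hom_sec_ext => W q s /=.
  by rewrite (std_res_comp _ _ (subset_trans q p)).
Defined.

End StandardCalculus.
(** * Identities on stalks from identities on sections *)

Section StalkOperations.
Context (k : fieldType) (X : topologicalType).
Implicit Types P Q R : presheaf k X.

Lemma germ_eq_refl P p (x : germ P p) : germ_eq x x.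
Proof.
exists (germ_dom x), (@subset_refl _ _), (@subset_refl _ _).
by split=> //; exact: germ_in.
Qed.

Lemma germ_eq_sym P p (x y : germ P p) : germ_eq x y -> germ_eq y x.
Proof. by move=> [W [i [j [Wp E]]]]; exists W, j, i. Qed.

Lemma germ_eq_trans P p (x y z : germ P p) :
  germ_eq x y -> germ_eq y z -> germ_eq x z.
Proof.
move=> [W [i [j [Wp E]]]] [W' [i' [j' [Wp' E']]]].
pose l := @opens_capl X W W'; pose l' := @opens_capr X W W'.
exists (opens_cap W W'), (subset_trans l i), (subset_trans l' j'); split=> //.
rewrite -(pres_comp i l) E -(pres_comp j' l') -E' (pres_comp _ _ (subset_trans l j)).
by rewrite (pres_comp _ _ (subset_trans l j)).
Qed.

Lemma stalk_ext P p (a b : stalk P p) : proj1_sig a = proj1_sig b -> a = b.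
Proof.
by case: a b => A a [B b] /= AB; subst B; congr exist; apply: Prop_irrelevance.
Qed.

Lemma stalk_of_eq P p (x y : germ P p) :
  germ_eq x y -> stalk_of x = stalk_of y.
Proof.
move=> xy; apply: stalk_ext; apply/seteqP; split=> z /=.
  exact: germ_eq_trans (germ_eq_sym xy).
exact: germ_eq_trans.
Qed.

Lemma stalk_repK P p (a : stalk P p) : stalk_of (stalk_rep a) = a.
Proof.
by apply: stalk_ext; rewrite /stalk_rep; case: cid => x /= ->.
Qed.

Lemma stalk_rep_of P p (x : germ P p) : germ_eq x (stalk_rep (stalk_of x)).
Proof.
rewrite /stalk_rep; case: cid => y /= xy.
have : [set z | germ_eq y z] y by exact: germ_eq_refl.
by rewrite -xy.
Qed.

Lemma stalk_of_res P p (U W : opens X) (Up : oset U p) (Wp : oset W p) (WU : W `<=` U)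
    (s : P U) :
  stalk_of (Germ Up s) = stalk_of (Germ Wp (pres WU s)).
Proof.
apply: stalk_of_eq; exists W, WU, (@subset_refl _ _); split=> //=.
by rewrite pres_id.
Qed.

(** The operation on stalks, defined through chosen representatives, can be
    computed on any sections over a common neighbourhood. *)
Lemma stalk_opE P Q R (op : forall U, P U -> Q U -> R U) p (W : opens X)
    (Wp : oset W p) (s : P W) (t : Q W) :
  (forall (U V : opens X) (q : V `<=` U) x y,
     pres q (op U x y) = op V (pres q x) (pres q y)) ->
  stalk_op op (stalk_of (Germ Wp s)) (stalk_of (Germ Wp t)) =
  stalk_of (Germ Wp (op W s t)).
Proof.
move=> op_nat; rewrite /stalk_op.
have [W1 [i1 [j1 [W1p E1]]]] := stalk_rep_of (Germ Wp s).
have [W2 [i2 [j2 [W2p E2]]]] := stalk_rep_of (Germ Wp t).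
set x := stalk_rep (stalk_of (Germ Wp s)) in i1 j1 E1 *.
set y := stalk_rep (stalk_of (Germ Wp t)) in i2 j2 E2 *.
apply: stalk_of_eq => /=.
pose l := @opens_capl X W1 W2; pose l' := @opens_capr X W1 W2.
have d : opens_cap W1 W2 `<=` opens_cap (germ_dom x) (germ_dom y).
  by move=> z [/j1 ? /j2 ?].
exists (opens_cap W1 W2), d, (subset_trans l i1); split=> //=.
rewrite !op_nat; congr op.
  rewrite (pres_comp _ _ (subset_trans l j1)) -(pres_comp j1 l) -E1.
  by rewrite (pres_comp _ _ (subset_trans l i1)).
rewrite (pres_comp _ _ (subset_trans l' j2)) -(pres_comp j2 l') -E2.
by rewrite (pres_comp _ _ (subset_trans l i1)).
Qed.

End StalkOperations.

Section SectionwiseLaws.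
Context (k : fieldType) (H : hopf_algebra k) (X : topologicalType).
Context (F : comodule_algebra_sheaf H X).
Local Notation F_ := (alg_to_presheaf F).

Lemma hfun_vf_app (D : precalculus F) (U V : opens X) (p : V `<=` U) (x : D U)
    (s : F V) : hfun (vf_L x) p s = vf_app (pres p x) s.
Proof.
rewrite /vf_app vf_L_nat /=; apply: (congr1 (fun q : V `<=` U => hfun (vf_L x) q s)).
exact: Prop_irrelevance.
Qed.

Lemma vf_app_nat (D : precalculus F) (U V : opens X) (p : V `<=` U) (x : D U)
    (s : F U) : ares p (vf_app x s) = vf_app (pres p x) (ares p s).
Proof.
by rewrite -hfun_vf_app; exact: (hfun_nat (vf_L x) (@subset_refl _ U) p p s).
Qed.

Lemma bilin_vf_app (D : precalculus F) U : bilin (@vf_app _ _ _ F D U).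
Proof.
split=> [f|x]; first exact: vf_L_linear.
exact: (hfun_linear (vf_L x) (@subset_refl _ U)).
Qed.

Definition leibniz (D : precalculus F) := forall U (x : D U) (f f' : F U),
  vf_app x (f ∙ f') = vf_app x f ∙ f' + vf_app (vf_r x f) f'.

Lemma stalk_leibniz (D : precalculus F) : leibniz D ->
  forall (p : X) (x : stalk D p) (f f' : stalk F_ p),
    stalk_L x (stalk_mul f f') =
    stalk_add (stalk_mul (stalk_L x f) f') (stalk_L (stalk_r x f) f').
Proof.
move=> DL p x f f'.
rewrite -(stalk_repK x) -(stalk_repK f) -(stalk_repK f').
move: (stalk_rep x) (stalk_rep f) (stalk_rep f') => {x f f'}.
move=> [U Up x] [V Vp f] [V' Vp' f'].
pose W := opens_cap U (opens_cap V V').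
have Wp : oset W p by [].
have WU : W `<=` U by move=> z [].
have WV : W `<=` V by move=> z [_ []].
have WV' : W `<=` V' by move=> z [_ []].
rewrite (stalk_of_res Up Wp WU) (stalk_of_res Vp Wp WV) (stalk_of_res Vp' Wp WV').
move: (pres WU x) (pres WV f) (pres WV' f') => {WU WV WV' Up Vp Vp' x f f'}.
move=> x f f'.
have mul_nat (U1 V1 : opens X) (q : V1 `<=` U1) (a b : F_ U1) :
    pres q (a ∙ b : F_ U1) = (pres q a ∙ pres q b : F_ V1) by exact: aresM.
have add_nat (U1 V1 : opens X) (q : V1 `<=` U1) (a b : F_ U1) :
    pres q (a + b) = pres q a + pres q b by exact: linearD.
rewrite /stalk_mul /stalk_L /stalk_r /stalk_add.
rewrite !(stalk_opE _ _ _ mul_nat).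
rewrite !(stalk_opE (P := D) (Q := F_) (R := F_) _ _ _ (@vf_app_nat D)).
rewrite (stalk_opE (P := D) (Q := F_) (R := D) _ _ _ (@vf_r_nat _ _ _ _ D)).
rewrite !(stalk_opE _ _ _ mul_nat).
rewrite !(stalk_opE (P := D) (Q := F_) (R := F_) _ _ _ (@vf_app_nat D)).
rewrite (stalk_opE _ _ _ add_nat).
by rewrite DL.
Qed.

End SectionwiseLaws.

(** * The laws of the standard calculus *)

Section StandardLaws.
Context (k : fieldType) (H : hopf_algebra k) (g : bicovariant_qts H).
Context (X : topologicalType) (F : comodule_algebra_sheaf H X).
Local Notation D := (std_calculus g F).

Let rA U : comodule_algebra (@cas_coact k H X F U) := cas_comodule_algebra F U.

Lemma std_vf_app U (x : D U) f :
  vf_app x f = std_app (@cas_coact k H X F U) x f.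
Proof. by rewrite /vf_app /= std_res_id. Qed.

Lemma std_bimodule : is_bimodule_sheaf D.
Proof.
move=> U; split=> /=.
- exact: std_l1.
- exact: std_lM.
- exact: (std_r1 (rA U)).
- exact: (std_rM (rA U)).
- exact: (std_lr (rA U)).
Qed.

Lemma std_leibniz : leibniz D.
Proof. by move=> U x f f'; rewrite !std_vf_app (std_app_leibniz (rA U)). Qed.

Lemma std_left_linear (U V : opens X) (p : V `<=` U) f (x : D U) f' :
  hfun (vf_L (vf_l f x)) p f' = ares p f ∙ hfun (vf_L x) p f'.
Proof. by rewrite !hfun_vf_app vf_l_nat !std_vf_app (std_app_l (rA V)). Qed.

Lemma std_is_covariant : is_covariant D.
Proof.
move=> U; split; [exact: (std_comodule g (rA U))|exact: (std_covariant (rA U))|].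
have lD : linear (std_coact (@cas_coact k H X F U) : tens (F U) g -> _).
  exact: (@std_coact_linear k H g _ _ (rA U)).
have := @std_app_colinear k H g _ _ (rA U).
rewrite (colinear_diagP lD (calg_linear (rA U)) (bilin_std_app _ (rA U))) => E.
rewrite (colinear_diagP (@vf_coact_linear _ _ _ _ D U) (calg_linear (rA U))
  (bilin_vf_app D U)) => x f.
rewrite std_vf_app E; apply: eq_tsum => y c; apply: eq_tsum => f0 f1.
by rewrite std_vf_app.
Qed.

(** Surjectivity of the canonical map, which is left A-linear, in a form that
    passes to restrictions. *)
Definition galois_spanned (A : ualgType k) (r : A -> tens A H) :=
  forall h, exists t : tens A A,
     tsum t (fun a a' => tsum (r a') (fun a0 a1 => (a ∙ a0) ⊗ a1)) = uone ⊗ h.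

Lemma hopf_galois_spanned (A : ualgType k) (r : A -> tens A H) :
  comodule_algebra r -> hopf_galois r -> galois_spanned r.
Proof.
move=> rA' [q qK qK'] h; exists (repr (q (uone ⊗ h))).
have rl : linear r := calg_linear rA'.
rewrite -[RHS]qK' /galois_map /qlift.
have -> : (fun a a' => tmap (umul a) id (r a')) =
    (fun a a' => tsum (r a') (fun a0 a1 => (a ∙ a0) ⊗ a1)).
  by apply/funext => a; apply/funext => a'; rewrite tmapE //; lin.
by rewrite tliftE //; lin.
Qed.

Lemma galois_spanned_nat (A A' : ualgType k) (r : A -> tens A H)
    (r' : A' -> tens A' H) (phi : A -> A') :
  comodule_algebra r -> comodule_algebra r' -> linear phi -> phi uone = uone ->
  (forall a b, phi (a ∙ b) = phi a ∙ phi b) ->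
  (forall a, r' (phi a) = tmap phi id (r a)) ->
  galois_spanned r -> galois_spanned r'.
Proof.
move=> rA1 rA2 phil phi1 phiM phiC gal h.
have rl := calg_linear rA1; have rl' := calg_linear rA2.
have [t th] := gal h; exists (tmap phi phi t).
rewrite tsum_tmap //; last by lin.
have := congr1 (tmap phi id) th; rewrite tmap_pure // phi1 => <-.
rewrite [RHS]tmapE // tsum_tsum; last by lin.
apply: eq_tsum => a a'; rewrite tsum_tsum; last by lin.
rewrite phiC tsum_tmap //; last by lin.
by apply: eq_tsum => a0 a1; rewrite tsum_pure ?phiM //; lin.
Qed.

(** A section is zero if it is so on the open sets U cap V_j, where the Galois
    property of F(V_j) is available by restriction. *)
Lemma std_L_inj (J : Type) (V : J -> opens X) :
  \bigcup_j V j = [set: X] ->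
  (forall j, hopf_galois (@cas_coact k H X F (V j))) ->
  forall U, injective (@vf_L _ _ _ _ D U).
Proof.
move=> VX gal U x y xy.
have UE : oset U = \bigcup_j opens_cap U (V j).
  apply/seteqP; split=> z; last by case=> j _ [].
  have : [set: X] z by []; rewrite -VX => -[j _ Vz] Uz; by exists j.
apply: (sheaf_separated (@std_is_sheaf _ _ g X F) UE) => j p /=.
apply/eqP; rewrite -subr_eq0; apply/eqP.
apply: (std_app_faithful (rA _)) => [|f].
  apply: (galois_spanned_nat (rA (V j)) (rA _) (phi := ares (@opens_capr X U (V j)))).
  - exact: ares_linear.
  - exact: ares1.
  - exact: aresM.
  - exact: cas_nat.
  - exact: hopf_galois_spanned (rA _) (gal j).
rewrite (linB _ _ ((bilin_std_app g (rA _)).1 f)).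
have := congr1 (fun L => @hfun k X (alg_to_presheaf F) (alg_to_presheaf F) U L _ p f) xy.
move=> /= ->.
by rewrite subrr.
Qed.

End StandardLaws.
(** * Transport of the laws along isomorphisms *)

Section Transport.
Context (k : fieldType) (H : hopf_algebra k) (X : topologicalType).
Context (F : comodule_algebra_sheaf H X).
Context (D D' : precalculus F) (phi : forall U : opens X, D U -> D' U).
Arguments phi {U} _.
Hypothesis phi_iso : precalculus_iso (@phi).

Let phi_linear U : linear (@phi U). Proof. by case: phi_iso => /(_ U) []. Qed.

Let phi_surj U (y : D' U) : exists x, phi x = y.
Proof.
by case: phi_iso => /(_ U) [_ [psi _ psiK]] _ _ _ _; exists (psi y).
Qed.

Let phi_inj U : injective (@phi U).
Proof. by case: phi_iso => /(_ U) [_ /bij_inj]. Qed.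

Let phi_l U f (x : D U) : phi (vf_l f x) = vf_l f (phi x).
Proof. by case: phi_iso => _ _ /(_ U f x) []. Qed.

Let phi_r U (x : D U) f : phi (vf_r x f) = vf_r (phi x) f.
Proof. by case: phi_iso => _ _ /(_ U f x) []. Qed.

Let phi_coact U (x : D U) : vf_coact (phi x) = tmap (@phi U) id (vf_coact x).
Proof. by case: phi_iso => _ _ _ /(_ U x). Qed.

Let phi_L U (x : D U) : vf_L (phi x) = vf_L x.
Proof. by case: phi_iso. Qed.

Let phi_app U (x : D U) f : vf_app (phi x) f = vf_app x f.
Proof. by rewrite /vf_app phi_L. Qed.

Lemma bimodule_transport : is_bimodule_sheaf D -> is_bimodule_sheaf D'.
Proof.
move=> DB U; have [l1 lM r1 rM lr] := DB U; split.
- by move=> y; have [x <-] := phi_surj y; rewrite -phi_l l1.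
- by move=> f f' y; have [x <-] := phi_surj y; rewrite -!phi_l lM.
- by move=> y; have [x <-] := phi_surj y; rewrite -phi_r r1.
- by move=> y f f'; have [x <-] := phi_surj y; rewrite -!phi_r rM.
- by move=> f y f'; have [x <-] := phi_surj y; rewrite -!(phi_l, phi_r) lr.
Qed.

Lemma leibniz_transport : leibniz D -> leibniz D'.
Proof.
by move=> DL U y f f'; have [x <-] := phi_surj y; rewrite -phi_r !phi_app DL.
Qed.

Lemma L_inj_transport : (forall U, injective (@vf_L _ _ _ _ D U)) ->
  forall U, injective (@vf_L _ _ _ _ D' U).
Proof.
move=> Dinj U y y'; have [x <-] := phi_surj y; have [x' <-] := phi_surj y'.
by rewrite !phi_L => /Dinj ->.
Qed.

Lemma left_linear_transport :
  (forall (U V : opens X) (p : V `<=` U) f (x : D U) f',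
    hfun (vf_L (vf_l f x)) p f' = ares p f ∙ hfun (vf_L x) p f') ->
  forall (U V : opens X) (p : V `<=` U) f (x : D' U) f',
    hfun (vf_L (vf_l f x)) p f' = ares p f ∙ hfun (vf_L x) p f'.
Proof.
by move=> Dl U V p f y f'; have [x <-] := phi_surj y; rewrite -phi_l !phi_L Dl.
Qed.

Lemma covariant_transport : is_covariant D -> is_covariant D'.
Proof.
move=> DC U; have [cD covD appD] := DC U.
have lc := comodule_linear cD.
have lc' : linear (@vf_coact _ _ _ _ D' U) := @vf_coact_linear _ _ _ _ D' U.
have rl := calg_linear (cas_comodule_algebra F U).
have lphi := @phi_linear U.
have bl := @vf_l_bilin _ _ _ _ D U; have br := @vf_r_bilin _ _ _ _ D U.
have bl' := @vf_l_bilin _ _ _ _ D' U; have br' := @vf_r_bilin _ _ _ _ D' U.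
split.
- split=> [//|y|y]; have [x <-] := phi_surj y; rewrite phi_coact.
    rewrite tassocE !tsum_tmap //; try by lin.
    have [_ /(_ x) xA _] := cD.
    have := congr1 (fun t => tsum t (fun v w => phi v ⊗ w)) xA.
    rewrite tassocE tsum_tmap //; [|by lin].
    rewrite tsum_tsum; last by lin.
    rewrite tsum_tmap //; [|by lin|by lin].
    move=> E; rewrite [RHS]tmapE //; [|by lin].
    rewrite [RHS]tsum_tmap //; [|by lin].
    rewrite -E; apply: eq_tsum => v h; rewrite phi_coact tsum_tmap //; [|by lin].
    rewrite tsum_tsum; last by lin.
    by apply: eq_tsum => u h'; rewrite tsum_pure //; lin.
  rewrite tliftE; last by lin.
  rewrite tsum_tmap //; [|by lin].
  by rewrite (coact_counit cD (T := @phi U)).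
- move=> f y f'; have [x <-] := phi_surj y.
  rewrite -phi_l -phi_r !phi_coact covD tmapE //.
  rewrite !tprodE // tsum_tsum; last by lin.
  rewrite !tsum_tsum; try by lin.
  apply: eq_tsum => f0 f1; rewrite tsum_tmap //; [|by lin].
  rewrite !tsum_tsum; try by lin.
  apply: eq_tsum => v h; rewrite !tsum_pure; try by lin.
  rewrite tsum_tsum; last by lin.
  apply: eq_tsum => f0' f1'; rewrite tsum_pure; last by lin.
  by rewrite phi_r phi_l.
have bapp := bilin_vf_app D U.
rewrite (colinear_diagP lc' rl (bilin_vf_app D' U)) => y f.
have [x <-] := phi_surj y; rewrite phi_app.
move: appD; rewrite (colinear_diagP lc rl bapp) => ->.
have bapp' := bilin_vf_app D' U.
rewrite phi_coact tsum_tmap //; [|by lin].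
by apply: eq_tsum => v h; apply: eq_tsum => f0 f1; rewrite phi_app.
Qed.

End Transport.

(** * Extension from the base *)

Section Base.
Context (M : topologicalType) (C : finite_cover M) (k : fieldType).
Local Notation X := (cover_space C).
Implicit Types P Q : presheaf k X.

Lemma base_cover (U : opens X) :
  oset U = \bigcup_(j : {I : multi_index C | base_open I `<=` U})
    base_open (sval j).
Proof.
apply/seteqP; split=> [x Ux|x [[I IU] _ /= /IU]] //.
have [S US] : cover_open C (oset U) := oopen U.
have [I SI Ix] : (\bigcup_(I in S) cover_cap I) x by rewrite -US.
have IU : base_open I `<=` U by rewrite US => y Iy; exists I.
by exists (exist (fun I => base_open I `<=` U) I IU).
Qed.

Lemma base_separated P (U : opens X) (x y : P U) : is_sheaf P ->
  (forall (I : multi_index C) (p : base_open I `<=` U), pres p x = pres p y) -> x = y.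
Proof.
by move=> Psh xy; apply: (sheaf_separated Psh (base_cover U)) => -[I IU] p.
Qed.

(** The slices of the difference are sections whose restrictions to the base
    vanish. *)
Lemma base_separated_tens P (W : lmodType k) (U : opens X) (t t' : tens (P U) W) :
  is_sheaf P ->
  (forall (I : multi_index C) (p : base_open I `<=` U),
     tmap (pres p) (id : W -> W) t = tmap (pres p) (id : W -> W) t') -> t = t'.
Proof.
move=> Psh tt'; apply/eqP; rewrite -subr_eq0; apply/eqP.
apply: tens_separated_r => psi.
apply: (base_separated Psh) => I p.
have lp : linear (pres p : P U -> P (base_open I)) by exact: linearP.
have := congr1 (fun t => tsum t (fun v w => psi w *: v)) (tt' I p).
rewrite !tsum_tmap //; try by lin.
rewrite (linB _ _ (tsum_linear (_ : bilin (fun v w => psi w *: v)))); last by lin.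
rewrite linearB linear0 /= !(lin_tsum _ _ lp) => E.
apply/eqP; rewrite subr_eq0; apply/eqP.
transitivity (tsum t (fun v w => psi w *: pres p v)).
  by apply: eq_tsum => v w; rewrite linearZ.
by rewrite E; apply: eq_tsum => v w; rewrite linearZ.
Qed.

(** The images over the base elements contained in U are glued in Q. They agree
    on overlaps because this can be tested on the base elements contained in the
    overlap. *)
Lemma base_extension P Q
    (m : forall I : multi_index C, P (base_open I) -> Q (base_open I)) :
  is_sheaf Q ->
  (forall (I J : multi_index C) (p : base_open J `<=` base_open I) x,
     pres p (m I x) = m J (pres p x)) ->
  exists phi : forall U, P U -> Q U,
    forall (U : opens X) (I : multi_index C) (p : base_open I `<=` U) x,
      pres p (phi U x) = m I (pres p x).
Proof.
move=> Qsh m_nat.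
suff ext (U : opens X) (x : P U) : exists y : Q U,
    forall (I : multi_index C) (p : base_open I `<=` U), pres p y = m I (pres p x).
  exists (fun U x => projT1 (cid (ext U x))) => U I p x.
  by case: cid.
have [j j' W p q|y [yP _]] := Qsh _ _ _ (base_cover U)
    (fun j => m (sval j) (pres (proj2_sig j) x)).
  apply: (base_separated Qsh) => K r.
  rewrite (pres_comp _ _ (subset_trans r p)) (pres_comp _ _ (subset_trans r q)).
  rewrite !m_nat; congr (m K _).
  have KU : base_open K `<=` U by apply: subset_trans (proj2_sig j); apply: subset_trans p.
  by rewrite !(pres_comp _ _ KU).
exists y => I p; exact: (yP (exist _ I p) p).
Qed.

End Base.
Section Prescription.
Context (k : fieldType) (H : hopf_algebra k) (g : bicovariant_qts H).
Context (M : topologicalType) (C : finite_cover M).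
Context (F : comodule_algebra_sheaf H (cover_space C)).
Local Notation X := (cover_space C).
Let rA U : comodule_algebra (@cas_coact k H X F U) := cas_comodule_algebra F U.

Local Notation base_iso D :=
  (forall I : multi_index C, tens (F (base_open I)) g -> D (base_open I)).

Lemma base_morphism (D D' : precalculus F) (i : base_iso D) (i' : base_iso D') :
  given_on_base i -> given_on_base i' ->
  exists phi : forall U, D U -> D' U,
    (forall (U V : opens X) (p : V `<=` U) x, pres p (phi U x) = phi V (pres p x)) /\
    forall I t, phi (base_open I) (i I t) = i' I t.
Proof.
move=> [i_iso i_nat _ _ _] [i'_iso i'_nat _ _ _].
have Di' : is_sheaf D' := @vf_is_sheaf _ _ _ _ D'.
have surj I (x : D (base_open I)) : exists t, i I t = x.
  by have [_ [j _ jK]] := i_iso I; exists (j x).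
pose m I x := i' I (projT1 (cid (surj I x))).
have inj I : injective (i I) by apply: bij_inj; case: (i_iso I).
have mi I t : m I (i I t) = i' I t.
  by rewrite /m; case: cid => u /= /inj ->.
have [I J p x|phi phiE] := base_extension (m := m) Di'.
  by have [t <-] := surj I x; rewrite i_nat !mi i'_nat.
exists phi; split=> [U V p x|I t].
  apply: (base_separated Di') => I q.
  have IU : base_open I `<=` U by apply: subset_trans p.
  by rewrite phiE !(pres_comp _ _ IU) phiE.
apply: (base_separated Di') => J p.
by rewrite phiE i_nat mi i'_nat.
Qed.

(** A natural family on D is determined by its values on the images of i,
    because the latter fill the sections over the base. *)
Lemma base_rigid (D D' : precalculus F) (i : base_iso D)
    (phi psi : forall U, D U -> D' U) :
  given_on_base i ->
  (forall (U V : opens X) (p : V `<=` U) x, pres p (phi U x) = phi V (pres p x)) ->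
  (forall (U V : opens X) (p : V `<=` U) x, pres p (psi U x) = psi V (pres p x)) ->
  (forall I t, phi (base_open I) (i I t) = psi (base_open I) (i I t)) ->
  forall U x, phi U x = psi U x.
Proof.
move=> [i_iso _ _ _ _] phi_nat psi_nat phipsi U x.
apply: (base_separated (@vf_is_sheaf _ _ _ _ D')) => I p.
rewrite phi_nat psi_nat; have [_ [j _ jK]] := i_iso I.
rewrite -(jK (pres p x)); exact: phipsi.
Qed.

(** The two extensions are mutually inverse by [base_rigid]. Every compatibility
    is an equality of sections, or of elements of D'(U) (x) H, hence may be
    checked over the base, where it is part of the prescription. *)
Lemma base_isomorphism (D D' : precalculus F) (i : base_iso D) (i' : base_iso D') :
  given_on_base i -> given_on_base i' ->
  exists phi : forall U, D U -> D' U, precalculus_iso phi /\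
    forall I t, phi (base_open I) (i I t) = i' I t.
Proof.
move=> iP i'P.
have [phi [phi_nat phiE]] := base_morphism iP i'P.
have [psi [psi_nat psiE]] := base_morphism i'P iP.
exists phi; split=> //.
have phiK U : cancel (phi U) (psi U).
  apply: (base_rigid (phi := fun U x => psi U (phi U x)) iP) => //.
    by move=> U' V p x; rewrite psi_nat phi_nat.
  by move=> I t; rewrite phiE psiE.
have psiK U : cancel (psi U) (phi U).
  apply: (base_rigid (phi := fun U x => phi U (psi U x)) i'P) => //.
    by move=> U' V p x; rewrite phi_nat psi_nat.
  by move=> I t; rewrite psiE phiE.
case: iP i'P => [i_iso i_nat i_lr i_coact i_app] [i'_iso i'_nat i'_lr i'_coact i'_app].
have surj I (x : D (base_open I)) : exists t, i I t = x.
  by have [_ [j _ jK]] := i_iso I; exists (j x).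
have li I : is_linear _ _ (i I) := (i_iso I).1.
have li' I : is_linear _ _ (i' I) := (i'_iso I).1.
have D'sh : is_sheaf D' := @vf_is_sheaf _ _ _ _ D'.
have phi_linear U : linear (phi U).
  move=> a x y; apply: (base_separated D'sh) => I p.
  rewrite linearP !phi_nat linearP.
  have [t <-] := surj _ (pres p x); have [u <-] := surj _ (pres p y).
  by rewrite -li !phiE li'.
split=> [U|U V p x|U f x|U x|U x].
- by split; [exact: phi_linear|exists (psi U); [exact: phiK|exact: psiK]].
- exact: phi_nat.
- split.
    apply: (base_separated D'sh) => I p; rewrite phi_nat !vf_l_nat phi_nat.
    have [t <-] := surj _ (pres p x); rewrite phiE; move: (ares p f) => {}f.
    have bl := @vf_l_bilin _ _ _ _ D (base_open I).
    have bl' := @vf_l_bilin _ _ _ _ D' (base_open I).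
    have lphi := @phi_linear (base_open I).
    have := li I; have := li' I; rewrite /is_linear => liI' liI.
    move: t; apply: tens_linear_ext; [by lin|by lin|move=> a Y].
    by rewrite (i_lr I f a Y).1 phiE (i'_lr I f a Y).1.
  apply: (base_separated D'sh) => I p; rewrite phi_nat !vf_r_nat phi_nat.
  have [t <-] := surj _ (pres p x); rewrite phiE; move: (ares p f) => {}f.
  have br := @vf_r_bilin _ _ _ _ D (base_open I).
  have br' := @vf_r_bilin _ _ _ _ D' (base_open I).
  have lphi := @phi_linear (base_open I).
  have := li I; have := li' I; rewrite /is_linear => liI' liI.
  move: t; apply: tens_linear_ext; [by lin|by lin|move=> a Y].
  by rewrite (i_lr I a f Y).2 phiE (i'_lr I a f Y).2.
- have lphi := @phi_linear U.
  have lc := @vf_coact_linear _ _ _ _ D U.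
  apply: (base_separated_tens D'sh) => I p.
  have lp : linear (pres p : D' U -> D' (base_open I)) by exact: linearP.
  have lp' : linear (pres p : D U -> D (base_open I)) by exact: linearP.
  rewrite -vf_coact_nat phi_nat.
  have lphi' := @phi_linear (base_open I).
  transitivity (tmap (phi (base_open I)) id (vf_coact (pres p x))); last first.
    rewrite vf_coact_nat [RHS]tmapE // tsum_tmap //; try by lin.
    rewrite [LHS]tmapE // tsum_tmap //; try by lin.
    by apply: eq_tsum => v h; rewrite phi_nat.
  have [t <-] := surj _ (pres p x); rewrite phiE.
  have lcI := @vf_coact_linear _ _ _ _ D (base_open I).
  have lcI' := @vf_coact_linear _ _ _ _ D' (base_open I).
  have := li I; have := li' I; rewrite /is_linear => liI' liI.
  rewrite tmapE //.
  move: t; apply: tens_linear_ext; [by lin|by lin|move=> a Y].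
  rewrite i_coact i'_coact tsum_tmap //; try by lin.
  rewrite tmapE //.
  by apply: eq_tsum => u h; rewrite phiE.
apply: hom_sec_ext => V p s; rewrite !hfun_vf_app phi_nat.
move: (pres p x) => {x p} x.
apply: (base_separated (@cas_is_sheaf _ _ _ F)) => I p /=.
rewrite !vf_app_nat phi_nat.
have [t <-] := surj _ (pres p x); rewrite phiE; move: (ares p s) => {}s.
have bapp := bilin_vf_app D (base_open I).
have bapp' := bilin_vf_app D' (base_open I).
have := li I; have := li' I; rewrite /is_linear => liI' liI.
move: t; apply: tens_linear_ext; [by lin|by lin|move=> a Y].
by rewrite i_app i'_app.
Qed.

Lemma std_given :
  given_on_base (D := std_calculus g F) (fun I (t : tens (F (base_open I)) g) => t).
Proof.
split=> [I|//|I f f' Y|I f Y|I f Y f'].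
- by split=> //; exists id.
- have rl := calg_linear (rA (base_open I)).
  split; first exact: std_l_pure.
  rewrite tliftE; last by lin.
  exact: std_r_pure.
- have rl := calg_linear (rA (base_open I)).
  rewrite tmapE //.
  rewrite tsum_tpure tprodE; last by lin.
  exact: std_coact_pure.
have rl := calg_linear (rA (base_open I)).
rewrite std_vf_app tliftE; last by lin.
exact: std_app_pure.
Qed.

End Prescription.

Theorem proposition4p5 (k : fieldType) (H : hopf_algebra k)
    (g : bicovariant_qts H) (M : topologicalType) (O : alg_presheaf k M)
    (O_sheaf : is_sheaf (alg_to_presheaf O)) (C : finite_cover M)
    (F : comodule_algebra_sheaf H (cover_space C))
    (F_qpb : quantum_principal_bundle (coarse_presheaf C O) F) :
  (* the prescription on the base extends to a sheaf with operations *)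
  (exists (D : precalculus F)
     (i : forall I : multi_index C,
        tens (F (base_open I)) g -> D (base_open I)),
     given_on_base i) /\
  (* uniquely, up to a unique isomorphism *)
  (forall (D D' : precalculus F)
     (i : forall I : multi_index C,
        tens (F (base_open I)) g -> D (base_open I))
     (i' : forall I : multi_index C,
        tens (F (base_open I)) g -> D' (base_open I)),
     given_on_base i -> given_on_base i' ->
     exists! phi : forall U : opens (cover_space C), D U -> D' U,
       precalculus_iso phi /\
       forall (I : multi_index C) t, phi (base_open I) (i I t) = i' I t) /\
  (* and it is a right H-covariant first order vector field calculus *)
  (forall (D : precalculus F)
     (i : forall I : multi_index C,
        tens (F (base_open I)) g -> D (base_open I)),
     given_on_base i -> is_fovc D /\ is_covariant D).
Proof.
split; first by exists (std_calculus g F), (fun I t => t); exact: std_given.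
split=> [D D' i i' iP i'P|D i iP].
  have [phi [phi_iso phiE]] := base_isomorphism iP i'P.
  exists phi; split=> // psi [psi_iso psiE].
  apply: functional_extensionality_dep => U; apply/funext => x.
  case: phi_iso psi_iso => _ phi_nat _ _ _ [_ psi_nat _ _ _].
  by apply: (base_rigid iP) => // I t; rewrite phiE psiE.
have [phi [phi_iso _]] := base_isomorphism (@std_given _ _ g _ _ F) iP.
split; last exact: covariant_transport phi_iso (std_is_covariant g F).
have [J [V [VM VP]]] := F_qpb.
split.
- exact: bimodule_transport phi_iso (std_bimodule g F).
- apply: (L_inj_transport phi_iso); apply: (std_L_inj VM) => j.
  by have [] := VP j.
- exact: left_linear_transport phi_iso (@std_left_linear _ _ g _ F).
- exact: stalk_leibniz (leibniz_transport phi_iso (@std_leibniz _ _ g _ F)).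
Qed.
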